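(* For every $p\in[0,1]^N$ one has $p\in\mathcal R_{N,d}$ if and only if $\|p\|_{\mathcal Q}^*\le 1$. In other words, $\mathcal R_{N,d}$ is the intersection of $[0,1]^N$ with the closed unit ball of the dual norm $\|\cdot\|_{\mathcal Q}^*$.
   Context: Fix integers $d\ge 2$, $N\ge 1$. Let $|\Omega\rangle=\sum_{i=1}^d|i\rangle\otimes|i\rangle\in\mathbb C^d\otimes\mathbb C^d$ (unnormalized) and $\omega=|\Omega\rangle\langle\Omega|$. On $(\mathbb C^d)^{\otimes(N+1)}$, with tensor factors labelled $0,1,\dots,N$, $\omega_{(0,i)}\otimes I^{\otimes(N-1)}$ denotes the operator acting as $\omega$ on factors $0$ and $i$ and as the identity on the other factors. A quantum channel $T:\mathcal M_d\to\mathcal M_d^{\otimes N}$ is a completely positive trace-preserving linear map; its marginals are $T_i(\rho)=\mathrm{Tr}_{\{1,\dots,N\}\setminus\{i\}}[T(\rho)]$. The cloning region is $\mathcal R_{N,d}=\{p\in[0,1]^N:\ \exists$ a quantum channel $T$ with $T_i(\rho)=p_i\rho+(1-p_i)I/d$ for all density matrices $\rho\in\mathcal M_d$ and all $1\le i\le N\}$. For $x\in\mathbb R^N$ let $S_x=\sum_{i=1}^N|x_i|\,\omega_{(0,i)}\otimes I^{\otimes(N-1)}$ and define the $\mathcal Q$-norm $\|x\|_{\mathcal Q}=\frac{d\,\lambda_{\max}(S_x)-\|x\|_1}{d^2-1}$, where $\lambda_{\max}$ is the largest eigenvalue and $\|x\|_1=\sum_i|x_i|$. Its dual norm is $\|y\|^*_{\mathcal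 Q}=\sup_{x\neq 0}\langle y,x\rangle/\|x\|_{\mathcal Q}$. *)

(* Defs.v *)
(* R : realType (a real-closed field with sup), complex numbers C := R[i]
   from mathcomp-real-closed. Operators on (C^d)^{\otimes N} are represented as functions
   of two indices ranging over the finite type {ffun 'I_N -> 'I_d} (multi-indices). *)
From HB Require Import structures.
From mathcomp Require Import all_boot all_order all_algebra.
From mathcomp Require Import all_classical all_reals.
From mathcomp Require Import ereal.
From mathcomp Require Import complex.
Set Implicit Arguments. Unset Strict Implicit. Unset Printing Implicit Defensive.
Import Order.TTheory GRing.Theory Num.Theory.
Local Open Scope ring_scope.
Local Open Scope complex_scope.

Section Defs.
Variable R : realType.
Local Notation C := R[i].

(* operators on a finite-dimensional space with basis indexed by a finType I *)
Definition op (I : finType) := I -> I -> C.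

(* multi-index for (C^d)^{\otimes n} *)
Definition mi (n d : nat) := {ffun 'I_n -> 'I_d}.

Definition tr (I : finType) (A : op I) : C := \sum_(i : I) A i i.

Definition psd (I : finType) (A : op I) : Prop :=
  forall v : I -> C, 0 <= \sum_(i : I) \sum_(j : I) (v i)^* * A i j * v j.

Definition density (I : finType) (rho : op I) : Prop := psd rho /\ tr rho = 1.

Definition lin_map (D E : finType) := op D -> op E.

Definition is_linear (D E : finType) (T : lin_map D E) : Prop :=
  forall (a : C) (A B : op D) (i j : E),
    T (fun k l => a * A k l + B k l) i j = a * T A i j + T B i j.

(* (id_k \otimes T) applied to X acting on C^k \otimes C^D *)
Definition ampl (k : nat) (D E : finType) (T : lin_map D E)
  (X : op ('I_k * D)%type) : op ('I_k * E)%type :=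
  fun u v => T (fun e f => X (u.1, e) (v.1, f)) u.2 v.2.

Definition completely_positive (D E : finType) (T : lin_map D E) : Prop :=
  forall (k : nat) (X : op ('I_k * D)%type), psd X -> psd (ampl T X).

Definition trace_preserving (D E : finType) (T : lin_map D E) : Prop :=
  forall A : op D, tr (T A) = tr A.

Definition quantum_channel (D E : finType) (T : lin_map D E) : Prop :=
  [/\ is_linear T, completely_positive T & trace_preserving T].

(* i-th marginal: partial trace over all output factors except i *)
Definition marginal (N d : nat) (T : lin_map 'I_d (mi N d)) (i : 'I_N)
  (rho : op 'I_d) : op 'I_d :=
  fun a b => \sum_(e : mi N d | e i == a)
     T rho e [ffun k => if k == i then b else e k].

Definition depol (d : nat) (p : R) (rho : op 'I_d) : op 'I_d :=
  fun a b => p%:C * rho a b + (1 - p)%:C * ((a == b)%:R / d%:R).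

Definition cloning_region (N d : nat) : set ('I_N -> R) :=
  [set p | (forall i, 0 <= p i <= 1) /\
     exists T : lin_map 'I_d (mi N d), quantum_channel T /\
       forall (i : 'I_N) (rho : op 'I_d), density rho ->
         marginal T i rho = depol (p i) rho].

(* omega_{(0,i)} \otimes I on (C^d)^{\otimes (N+1)}, factors labelled 0..N,
   where i : 'I_N stands for factor i+1 = lift ord0 i; omega = |Omega><Omega| with
   Omega = sum_a |a>|a>, so omega_{(a,b),(c,e)} = [a = b][c = e]. Real entries. *)
Definition omega_0i (N d : nat) (i : 'I_N) (u v : mi N.+1 d) : R :=
  ((u ord0 == u (lift ord0 i)) && (v ord0 == v (lift ord0 i)) &&
   [forall k : 'I_N.+1, (k != ord0) && (k != lift ord0 i) ==> (u k == v k)])%:R.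

Arguments omega_0i {N} d i u v.

Definition S_op (N d : nat) (x : 'I_N -> R) (u v : mi N.+1 d) : R :=
  \sum_(i < N) `|x i| * omega_0i d i u v.

Arguments S_op {N} d x u v.

Definition is_eigenvalue (I : finType) (A : I -> I -> R) (l : R) : Prop :=
  exists v : I -> R, (exists i, v i != 0) /\
    forall i, \sum_(j : I) A i j * v j = l * v i.

Definition lambda_max (I : finType) (A : I -> I -> R) : R :=
  sup [set l | is_eigenvalue A l].

Definition norm1 (N : nat) (x : 'I_N -> R) : R := \sum_(i < N) `|x i|.

Definition Qnorm (N d : nat) (x : 'I_N -> R) : R :=
  (d%:R * lambda_max (S_op d x) - norm1 x) / (d%:R ^+ 2 - 1).

Arguments Qnorm {N} d x.

Definition Qnorm_dual (N d : nat) (y : 'I_N -> R) : \bar R :=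
  ereal_sup [set ((\sum_(i < N) y i * x i) / Qnorm d x)%:E
            | x in [set x : 'I_N -> R | exists i, x i != 0]].

End Defs.
Arguments omega_0i {R N} d i u v.
Arguments S_op {R N} d x u v.
Arguments Qnorm {R N} d x.
Arguments Qnorm_dual {R N} d y.

(* Main.v *)
(** A channel is encoded by its Choi operator J on factors 0..N, and fidelity to
    the i-th clone is Tr[J omega_(0,i)], which equals p_i (d^2 - 1) + 1. Pairing J
    with S_x and bounding by the largest eigenvalue gives the necessity of the
    dual-norm bound. Conversely, the normalized projection onto the top eigenspace
    of S_(x^+) commutes with the action of gl_d on (C^d)^* (x) (C^d)^(x)N, since
    every omega_(0,i) does, so no averaging over unitaries is needed. It attains
    d lambda_max against x^+, and where x_i <= 0 it is maximally mixed on output i,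
    with fidelity 1, the smallest value that p_i >= 0 allows. Hence every linear
    functional evaluates on some covariant Choi operator to at least its value at
    the target fidelities; by compactness and convexity the target itself is
    attained, and Schur's lemma for gl_d shows that the corresponding map is
    trace preserving with depolarizing marginals. *)

Require Import Defs.
From mathcomp Require Import all_boot all_order all_algebra.
From mathcomp Require Import all_classical all_reals ereal.
From mathcomp Require Import topology normedtype derive realfun.
From mathcomp Require Import complex.
From mathcomp Require Import ring lra.
Import Order.TTheory GRing.Theory Num.Theory numFieldNormedType.Exports.
Local Open Scope ring_scope.

Set Implicit Arguments. Unset Strict Implicit. Unset Printing Implicit Defensive.
Local Open Scope complex_scope.

(** * Exact solvability over compact convex sets *)

(** The coefficients stay existential, so that linearity of a compound expression follows from the
    closure lemmas below without computing them. *)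
Definition linear_functional (R : realType) (E : finType) (l : (E -> R) -> R) :=
  exists a : E -> R, forall y, l y = \sum_e a e * y e.

(* F is the intersection of all the half-spaces containing it *)
Definition closed_convex (R : realType) (E : finType) (F : (E -> R) -> Prop) :=
  forall y, (forall (a : E -> R) (b : R),
     (forall z, F z -> b <= \sum_e a e * z e) -> b <= \sum_e a e * y e) -> F y.

Section ClosedConvex.
Variables (R : realType) (E : finType).
Implicit Types (l : (E -> R) -> R) (F : (E -> R) -> Prop).

Lemma linear_functional_coord e : linear_functional (fun y : E -> R => y e).
Proof.
exists (fun e' => (e' == e)%:R) => y; rewrite (bigD1 e) //= eqxx mul1r big1 ?addr0 // => e' /negPf->.
by rewrite mul0r.
Qed.

Lemma linear_functional_scale c l : linear_functional l -> linear_functional (fun y => c * l y).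
Proof.
move=> [a la]; exists (fun e => c * a e) => y; rewrite la mulr_sumr.
by apply: eq_bigr => e _; rewrite mulrA.
Qed.

Lemma linear_functional_scaler c l : linear_functional l -> linear_functional (fun y => l y * c).
Proof.
by move=> /(linear_functional_scale c) [a la]; exists a => y; rewrite mulrC; exact: la.
Qed.

Lemma linear_functional_sum (T : finType) (l : T -> (E -> R) -> R) :
  (forall t, linear_functional (l t)) -> linear_functional (fun y => \sum_t l t y).
Proof.
move=> /choice [a la]; exists (fun e => \sum_t a t e) => y.
under eq_bigr do rewrite la; rewrite exchange_big /=.
by apply: eq_bigr => e _; rewrite mulr_suml.
Qed.

Lemma linear_functional_sub l l' : linear_functional l -> linear_functional l' ->
  linear_functional (fun y => l y - l' y).
Proof.
move=> [a la] [a' la']; exists (fun e => a e - a' e) => y; rewrite la la' -sumrB.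
by apply: eq_bigr => e _; rewrite mulrBl.
Qed.

Lemma closed_convex_ge l b : linear_functional l -> closed_convex (fun y => b <= l y).
Proof. by move=> [a la] y H; rewrite la; apply: H => z; rewrite la. Qed.

Lemma closed_convex_and F F' : closed_convex F -> closed_convex F' ->
  closed_convex (fun y => F y /\ F' y).
Proof.
by move=> cF cF' y H; split; [apply: cF|apply: cF'] => a b h; apply: H => z [] ? ?; exact: h.
Qed.

Lemma closed_convex_forall (T : Type) (F : T -> (E -> R) -> Prop) :
  (forall t, closed_convex (F t)) -> closed_convex (fun y => forall t, F t y).
Proof. by move=> cF y H t; apply: cF => a b h; apply: H => z Fz; apply: h. Qed.

Lemma closed_convex_eq l b : linear_functional l -> closed_convex (fun y => l y = b).
Proof.
move=> ll y H; apply/eqP; rewrite eq_le; apply/andP; split.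
  (* The upper bound on [l y] is the half-space of [-l] with bound [-b]. *)
  have [a la] := linear_functional_scale (-1) ll.
  have := H a (- b); rewrite -la mulN1r lerN2; apply=> z <-.
  by rewrite -la mulN1r.
have [a la] := ll; rewrite la; apply: H => z <-.
by rewrite la.
Qed.

End ClosedConvex.

(** A form of hyperplane separation: a point that no linear functional strictly separates from a
    compact convex image lies in it. The proof takes the point of [F] whose image is nearest to
    [q]. *)
Lemma compact_convex_solvable (R : realType) (E : finType)
  (F : (E -> R) -> Prop) (M : R) (n : nat) (g : 'I_n -> E -> R) (q : 'I_n -> R) :
  closed_convex F -> 0 <= M -> (forall y, F y -> forall e, `|y e| <= M) ->
  (forall x : 'I_n -> R, exists2 y, F y &
     \sum_i x i * q i <= \sum_i x i * \sum_e g i e * y e) ->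
  exists2 y, F y & forall i, \sum_e g i e * y e = q i.
Proof.
move=> cF M0 bndF H.
pose Y (v : 'rV[R]_#|E|) e := v ord0 (enum_rank e).
pose A : set 'rV[R]_#|E| := [set v | F (Y v)]%classic.
have cl (a : E -> R) : continuous (fun v : 'rV[R]_#|E| => \sum_e a e * Y v e).
  apply: continuous_big => [|e _ v]; first exact: add_continuous.
  apply: (@continuousM _ _ (fun=> a e) (fun v => Y v e)); first exact: cst_continuous.
  exact: coord_continuous.
have clA : closed A.
  pose D : set ((E -> R) * R) := [set k | forall z, F z -> k.2 <= \sum_e k.1 e * z e]%classic.
  have -> : A = (\bigcap_(k in D) ((fun v => \sum_e k.1 e * Y v e) @^-1` [set x | k.2 <= x]))%classic.
    apply/seteqP; split => v /= Fv => [k Dk|]; first exact: Dk.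
    by apply: cF => a b h; apply: (Fv (a, b)).
  apply: closed_bigI => k _; apply: closed_comp; last exact: closed_ge.
  by move=> v _; apply: cl.
have cA : compact A.
  apply: bounded_closed_compact => //.
  exists M; split; first exact: num_real.
  move=> x Mx v Av /=.
  rewrite [leLHS]/Num.norm /= mx_normrE; apply: bigmax_le.
    by rewrite (le_trans _ (ltW Mx)) // M0.
  move=> [i j] _ /=; rewrite ord1 (le_trans _ (ltW Mx)) //.
  by have := bndF _ Av (enum_val j); rewrite /Y enum_valK.
have [y0 Fy0 _] := H (fun=> 0).
(* at the minimizer y of the squared distance phi to q, moving towards the point
   given by the hypothesis for x := q - g y would decrease phi unless x = 0 *)
pose phi (v : 'rV[R]_#|E|) := \sum_i (q i - \sum_e g i e * Y v e) ^+ 2.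
have cphi : continuous phi.
  apply: continuous_big => [|i _ v]; first exact: add_continuous.
  apply: (@continuous_comp _ _ _ (fun v => q i - \sum_e g i e * Y v e) (fun z : R => z ^+ 2)); last exact: exprn_continuous.
  by apply: (@continuousB _ _ _ (fun=> q i)); [exact: cst_continuous | exact: cl].
have YK (y : E -> R) : Y (\row_j y (enum_val j)) = y.
  by apply/funext => e; rewrite /Y mxE enum_rankK.
have A0 : (A !=set0)%classic by exists (\row_j y0 (enum_val j)); rewrite /A /= YK.
have [v /set_mem Av vmin] := compact_EVT_min A0 cA (continuous_subspaceT cphi).
exists (Y v) => // i.
pose x i := q i - \sum_e g i e * Y v e.
have [y Fy xy] := H x.
pose z i := \sum_e g i e * y e - \sum_e g i e * Y v e.
have xz : \sum_i x i ^+ 2 <= \sum_i x i * z i.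
  rewrite -subr_ge0 -sumrB; rewrite -subr_ge0 -sumrB in xy.
  by rewrite (eq_bigr _ (fun i _ => _ : _ = x i * (\sum_e g i e * y e) - x i * q i)) // => j _; rewrite /x /z; ring.
have step (t : R) : 0 <= t <= 1 -> \sum_i x i ^+ 2 <= \sum_i (x i - t * z i) ^+ 2.
  move=> /andP[t0 t1].
  pose y' e := (1 - t) * Y v e + t * y e.
  have lin (a : E -> R) : \sum_e a e * y' e = (1 - t) * (\sum_e a e * Y v e) + t * \sum_e a e * y e.
    by rewrite !mulr_sumr -big_split; apply: eq_bigr => e _; rewrite /y' /=; ring.
  have Fy' : F y'.
    (* Every half-space containing [F] contains both endpoints, hence the segment. *)
    apply: cF => a b h; rewrite lin.
    have := h _ Av; have := h _ Fy; nra.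
  have := vmin (\row_j y' (enum_val j)); rewrite inE /A /= YK => /(_ Fy').
  rewrite /phi YK => /le_trans; apply; apply: ler_sum => j _.
  by rewrite lin le_eqVlt; apply/orP; left; apply/eqP; rewrite /x /z; congr (_ ^+ 2); ring.
have quad t : \sum_i (x i - t * z i) ^+ 2 = \sum_i x i ^+ 2 - 2 * t * (\sum_i x i * z i) + t ^+ 2 * \sum_i z i ^+ 2.
  rewrite !mulr_sumr -sumrB -big_split; apply: eq_bigr => j _ /=; ring.
set X := \sum_i x i ^+ 2 in xz step quad.
set Z := \sum_i z i ^+ 2 in quad.
set W := \sum_i x i * z i in xz quad.
have Z0 : 0 <= Z by apply: sumr_ge0 => j _; apply: sqr_ge0.
have X0 : 0 <= X by apply: sumr_ge0 => j _; apply: sqr_ge0.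
have : X <= 0.
  rewrite leNgt; apply/negP => Xpos.
  (* Minimality along the segment gives 2 W <= t Z for 0 < t <= 1. This [t] satisfies t Z <= X,
     which contradicts W >= X > 0. *)
  pose t := X / (X + Z).
  have XZ : 0 < X + Z by lra.
  have tXZ : t * (X + Z) = X by rewrite /t divfK // gt_eqF.
  have t0 : 0 < t by rewrite divr_gt0.
  have t1 : t <= 1 by rewrite /t ler_pdivrMr // mul1r; lra.
  have := step t; rewrite (ltW t0) t1 quad => /(_ isT); nra.
move=> X00; have /eqP : X = 0 by apply/eqP; rewrite eq_le X00.
rewrite psumr_eq0 => [/allP /(_ i)|j _]; last exact: sqr_ge0.
by rewrite mem_index_enum sqrf_eq0 subr_eq0 => /(_ isT) /eqP.
Qed.

(** * Spectra of real symmetric operators *)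

(** The real matrix is diagonalized as a Hermitian one, so the orthonormal eigenvectors [w] are
    complex while the eigenvalues [m] are real. *)
Lemma real_symmetric_spectral (R : rcfType) (I : finType) (S : I -> I -> R) :
  (forall i j, S i j = S j i) ->
  exists (w : 'I_#|I| -> I -> R[i]) (m : 'I_#|I| -> R),
  [/\ forall k l, \sum_i (w k i)^* * w l i = (k == l)%:R,
      forall i j, \sum_k w k i * (w k j)^* = (i == j)%:R
    & forall i j, (S i j)%:C = \sum_k (m k)%:C * (w k i * (w k j)^*)].
Proof.
move=> symS.
pose A : 'M[R[i]]_#|I| := \matrix_(i, j) (S (enum_val i) (enum_val j))%:C.
have hA : A \is hermsymmx.
  apply: realsym_hermsym.
    apply/is_hermitianmxP; rewrite expr0 scale1r map_mx_id //.
    by apply/matrixP => i j; rewrite !mxE symS.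
  by apply/mxOverP => i j; rewrite mxE complex_real.
have /mxOverP Dreal := hermitian_spectral_diag_real hA.
have /orthomx_spectralP := hermitian_normalmx hA.
have := spectral_unitarymx A; move: Dreal.
set P := spectralmx A; set D := spectral_diag A => Dreal Pu AE.
have PP := unitarymxP Pu.
have PP' : map_mx Num.conj P^T *m P = 1%:M by apply: mulmx1C.
rewrite (invmx_unitary Pu) in AE.
(* Since A = P^* D P, the eigenvectors are the conjugated rows of P. *)
pose w k i := Num.conj (P k (enum_rank i)).
have wc k i : Num.conj (w k i) = P k (enum_rank i) by exact: conjCK.
exists w, (fun k => complex.Re (D 0 k)); split.
- move=> k l; have /matrixP /(_ k l) := PP; rewrite !mxE => <-.
  rewrite (reindex (enum_val : 'I_#|I| -> I)); last exact/onW_bij/enum_val_bij.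
  by apply: eq_bigr => i _; rewrite wc /w enum_valK !mxE.
- move=> i j; have /matrixP /(_ (enum_rank i) (enum_rank j)) := PP'.
  rewrite !mxE (inj_eq enum_rank_inj) => <-.
  by apply: eq_bigr => k _; rewrite wc !mxE.
- move=> i j; have /matrixP /(_ (enum_rank i) (enum_rank j)) := AE.
  rewrite mxE !enum_rankK => ->; rewrite mxE.
  apply: eq_bigr => k _; rewrite mul_mx_diag !mxE wc.
  have /RRe_real -> := Dreal 0 k.
  by rewrite mulrA; congr (_ * _); rewrite mulrC.
Qed.

Lemma complex_Re_sum (R : rcfType) (I : Type) (r : seq I) (P : pred I) (F : I -> R[i]) :
  complex.Re (\sum_(i <- r | P i) F i) = \sum_(i <- r | P i) complex.Re (F i).
Proof. by apply: (big_morph (@complex.Re R)) => // -[a b] [a' b']. Qed.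

Lemma complex_Im_sum (R : rcfType) (I : Type) (r : seq I) (P : pred I) (F : I -> R[i]) :
  complex.Im (\sum_(i <- r | P i) F i) = \sum_(i <- r | P i) complex.Im (F i).
Proof. by apply: (big_morph (@complex.Im R)) => // -[a b] [a' b']. Qed.

Lemma complex_ReMl (R : rcfType) (x : R) (z : R[i]) :
  complex.Re (x%:C * z) = x * complex.Re z.
Proof. by case: z => a b /=; rewrite mul0r subr0. Qed.

Lemma complex_ImMl (R : rcfType) (x : R) (z : R[i]) :
  complex.Im (x%:C * z) = x * complex.Im z.
Proof. by case: z => a b /=; rewrite mul0r addr0. Qed.

Lemma sum_deltal (A : pzSemiRingType) (I : finType) (j : I) (F : I -> A) :
  \sum_i (i == j)%:R * F i = F j.
Proof.
rewrite (bigD1 j) //= eqxx mul1r big1 ?addr0 // => i /negPf->.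
by rewrite mul0r.
Qed.

Lemma sum_deltar (A : pzSemiRingType) (I : finType) (j : I) (F : I -> A) :
  \sum_i F i * (i == j)%:R = F j.
Proof.
rewrite (bigD1 j) //= eqxx mulr1 big1 ?addr0 // => i /negPf->.
by rewrite mulr0.
Qed.

Section Spectrum.
Variables (R : realType) (I : finType) (S : I -> I -> R).
Hypothesis symS : forall i j, S i j = S j i.
Variables (w : 'I_#|I| -> I -> R[i]) (m : 'I_#|I| -> R).
Hypothesis orthw : forall k l, \sum_i (w k i)^* * w l i = (k == l)%:R.
Hypothesis complw : forall i j, \sum_k w k i * (w k j)^* = (i == j)%:R.
Hypothesis defS : forall i j, (S i j)%:C = \sum_k (m k)%:C * (w k i * (w k j)^*).

Let eigenw k i : \sum_j (S i j)%:C * w k j = (m k)%:C * w k i.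
Proof.
under eq_bigr => j _ do rewrite defS mulr_suml.
rewrite exchange_big /=.
under eq_bigr => l _.
  under eq_bigr => j _ do rewrite -!mulrA.
  rewrite -!mulr_sumr orthw mulrA.
over.
by rewrite sum_deltar.
Qed.

(** [is_eigenvalue] asks for a real vector: as [S] is real, the real and imaginary parts of [w k]
    both satisfy the eigenvector equation, and one of them is nonzero. *)
Lemma spectrum_is_eigenvalue k : is_eigenvalue S (m k).
Proof.
have wn0 : exists i, w k i != 0.
  apply/existsP; apply: contraT; rewrite negb_exists => /forallP w0.
  have := orthw k k; rewrite eqxx big1 => [/esym/eqP|i _]; first by rewrite oner_eq0.
  by have := w0 i; rewrite negbK => /eqP ->; rewrite mulr0.
have [i wi0] := wn0; move: wi0; case E: (w k i) => [a b]; rewrite eq_complex /= negb_and => /orP[] h.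
  exists (fun i => complex.Re (w k i)); split; first by exists i; rewrite E.
  by move=> j; have := congr1 (@complex.Re R) (eigenw k j);
    rewrite complex_Re_sum complex_ReMl => <-; apply: eq_bigr => l _; rewrite complex_ReMl.
exists (fun i => complex.Im (w k i)); split; first by exists i; rewrite E.
by move=> j; have := congr1 (@complex.Im R) (eigenw k j);
  rewrite complex_Im_sum complex_ImMl => <-; apply: eq_bigr => l _; rewrite complex_ImMl.
Qed.

Let coefw k (x : I -> R) := \sum_i (w k i)^* * (x i)%:C.

Let expand x i : (x i)%:C = \sum_k coefw k x * w k i.
Proof.
under eq_bigr do rewrite mulr_suml.
rewrite exchange_big /=.
under eq_bigr => j _.
  under eq_bigr => k _ do rewrite mulrAC [_ * w k i]mulrC.
  rewrite -mulr_suml complw eq_sym.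
over.
by rewrite sum_deltal.
Qed.

(** Orthogonality of eigenspaces: moving the symmetric [S] across the pairing of [w k] with [x]
    multiplies it by [m k] on one side and by [l] on the other. *)
Let coef_eigen l x (Sx : forall i, \sum_j S i j * x j = l * x i) k :
  m k != l -> coefw k x = 0.
Proof.
move=> ml.
have : (m k)%:C * coefw k x = l%:C * coefw k x.
  rewrite /coefw !mulr_sumr.
  under [RHS]eq_bigr => i _.
    rewrite mulrCA -rmorphM -Sx rmorph_sum mulr_sumr.
    under eq_bigr => j _ do rewrite rmorphM /= mulrCA mulrA.
  over.
  rewrite exchange_big /=; apply: eq_bigr => j _.
  rewrite -mulr_suml mulrA; congr (_ * _).
  have /(congr1 Num.conj) := eigenw k j; rewrite rmorphM /= => H.
  rewrite -[(m k)%:C]conjc_real -[LHS]H rmorph_sum /=.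
  apply: eq_bigr => i _; rewrite rmorphM /= symS; congr (_ * _).
  exact: conjc_real.
move/eqP; rewrite -subr_eq0 -mulrBl mulf_eq0 subr_eq0 => /orP[|/eqP //].
by move/eqP/complexI => H; rewrite H eqxx in ml.
Qed.

Lemma eigenvalue_in_spectrum l : is_eigenvalue S l -> exists k, m k = l.
Proof.
move=> [x [[i xi] Sx]].
suff /existsP [k /eqP <-] : [exists k, m k == l] by exists k.
apply: contraT => /existsPn nl.
have := expand x i; rewrite big1 => [/complexI /eqP|k _]; first by rewrite (negPf xi).
by rewrite (coef_eigen Sx) ?mul0r //; exact: nl.
Qed.

(** The supremum defining [lambda_max] runs over finitely many eigenvalues, and [i0] ensures that
    there is at least one, so it is attained. *)
Lemma lambda_max_spectrum (i0 : I) :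
  (exists k, m k = lambda_max S) /\ forall k, m k <= lambda_max S.
Proof.
have k0 : 'I_#|I| := enum_rank i0.
have [k _ kmax] := @arg_maxP _ _ _ k0 predT m isT.
suff -> : lambda_max S = m k by split; [exists k | move=> l; apply: kmax].
apply/eqP; rewrite eq_le; apply/andP; split.
  apply: ge_sup; first by exists (m k); apply: spectrum_is_eigenvalue.
  by move=> l /eigenvalue_in_spectrum [k' <-]; apply: kmax.
apply: ub_le_sup; last exact: spectrum_is_eigenvalue.
by exists (m k) => l /eigenvalue_in_spectrum [k' <-]; apply: kmax.
Qed.

Let qform (J : op R I) k : R[i] := \sum_i \sum_j J i j * (w k i * (w k j)^*).

Let qform_sum (J : op R I) (c : 'I_#|I| -> R[i]) :
  \sum_i \sum_j J i j * (\sum_k c k * (w k i * (w k j)^*)) = \sum_k c k * qform J k.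
Proof.
under eq_bigr => i _ do under eq_bigr => j _ do rewrite mulr_sumr.
under eq_bigr => i _ do rewrite exchange_big /=.
rewrite exchange_big /=; apply: eq_bigr => k _.
rewrite mulr_sumr; apply: eq_bigr => i _; rewrite mulr_sumr.
by apply: eq_bigr => j _; rewrite mulrCA.
Qed.

(** In the eigenbasis of [S] both sides have the same nonnegative weights [qform J k], multiplied by
    [m k] on the left and by [lambda_max S] on the right. *)
Lemma psd_pairing_le_lambda_max (i0 : I) (J : op R I) : psd J ->
  \sum_i \sum_j J i j * (S i j)%:C <= (lambda_max S)%:C * tr J.
Proof.
move=> psdJ; have [_ le_max] := lambda_max_spectrum i0.
have -> : tr J = \sum_k 1 * qform J k.
  rewrite -qform_sum; apply: eq_bigr => i _.
  rewrite -[LHS](sum_deltar i (J i)); apply: eq_bigr => j _.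
  by rewrite eq_sym -complw; congr (_ * _); apply: eq_bigr => k _; rewrite mul1r.
have -> : \sum_i \sum_j J i j * (S i j)%:C = \sum_k (m k)%:C * qform J k.
  by rewrite -qform_sum; apply: eq_bigr => i _; apply: eq_bigr => j _; rewrite defS.
rewrite mulr_sumr; apply: ler_sum => k _; rewrite mul1r.
apply: ler_wpM2r; last by rewrite lecR.
have := psdJ (fun i => (w k i)^*).
rewrite /qform; congr (0 <= _); apply: eq_bigr => i _; apply: eq_bigr => j _.
by rewrite conjCK mulrCA mulrA.
Qed.

(** [P] is the real part of the spectral projection onto the top eigenspace. As [S] and the test
    vectors are real, the identities for the complex projection pass to its real part. *)
Lemma top_eigenprojection : exists P : I -> I -> R,
  [/\ forall i j, P i j = P j i,
      forall i l, \sum_j S i j * P j l = lambda_max S * P i l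
    & forall x : I -> R, (forall i, \sum_j S i j * x j = lambda_max S * x i) ->
        forall i, \sum_j P i j * x j = x i].
Proof.
pose Q i j := \sum_(k | m k == lambda_max S) w k i * (w k j)^*.
exists (fun i j => complex.Re (Q i j)); split.
- move=> i j; have -> : Q i j = Num.conj (Q j i).
    rewrite rmorph_sum; apply: eq_bigr => k _.
    by rewrite rmorphM /= conjCK mulrC.
  by case: (Q j i).
- move=> i l; rewrite -complex_ReMl -(eq_bigr _ (fun j _ => complex_ReMl _ _)) -complex_Re_sum; congr complex.Re.
  under eq_bigr do rewrite mulr_sumr.
  rewrite exchange_big /= mulr_sumr; apply: eq_bigr => k /eqP <-.
  by rewrite mulrA -eigenw mulr_suml; apply: eq_bigr => j _; rewrite mulrA.
- move=> x Sx i; have -> : x i = complex.Re (x i)%:C by [].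
  under eq_bigr do rewrite mulrC -complex_ReMl.
  rewrite -complex_Re_sum expand; congr complex.Re.
  rewrite (bigID (fun k => m k == lambda_max S)) /= [X in _ + X]big1 ?addr0; last first.
    by move=> k mk; rewrite (coef_eigen Sx) ?mul0r.
  under eq_bigr do rewrite mulr_sumr.
  rewrite exchange_big /=; apply: eq_bigr => k _; rewrite /coefw mulr_suml.
  by apply: eq_bigr => j _; rewrite [RHS]mulrC mulrA [RHS]mulrA mulrC mulrA; congr (_ * _); rewrite mulrC.
Qed.

End Spectrum.

(** * The action of gl_d on tensor powers *)

Definition opmul (R : pzRingType) (I : finType) (A B : I -> I -> R) : I -> I -> R :=
  fun i j => \sum_k A i k * B k j.

Lemma opmulA (R : pzRingType) (I : finType) (A B C : I -> I -> R) :
  opmul A (opmul B C) = opmul (opmul A B) C.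
Proof.
apply/funext => i; apply/funext => j; rewrite /opmul.
under eq_bigr do rewrite mulr_sumr.
rewrite exchange_big /=; apply: eq_bigr => k _; rewrite mulr_suml.
by apply: eq_bigr => l _; rewrite mulrA.
Qed.

Definition optr (R : Type) (I : Type) (A : I -> I -> R) : I -> I -> R := fun i j => A j i.

Lemma optrM (R : comPzRingType) (I : finType) (A B : I -> I -> R) :
  optr (opmul A B) = opmul (optr B) (optr A).
Proof.
apply/funext => i; apply/funext => j.
by apply: eq_bigr => k _; rewrite mulrC.
Qed.

(** [L] preserves the eigenspace, so P L P = L P. The transpose of [L] also commutes with the
    symmetric [S], and transposing its identity gives P L P = P L. *)
Lemma eigenprojection_commutes (R : comPzRingType) (I : finType) (S P L : I -> I -> R) (l : R) :
  optr S = S -> optr P = P ->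
  (forall i j, opmul S P i j = l * P i j) ->
  (forall x : I -> R, (forall i, \sum_j S i j * x j = l * x i) ->
        forall i, \sum_j P i j * x j = x i) ->
  opmul L S = opmul S L -> opmul L P = opmul P L.
Proof.
move=> symS symP SP fixP.
(* the columns of L' P are l-eigenvectors of S, hence fixed by P *)
have half L' : opmul L' S = opmul S L' -> opmul P (opmul L' P) = opmul L' P.
  move=> cL; apply/funext => i; apply/funext => j.
  apply: (fixP (fun k => opmul L' P k j)) => k.
  rewrite -/(opmul S (opmul L' P) k j) opmulA -cL -opmulA /opmul mulr_sumr.
  by apply: eq_bigr => m _; rewrite -/(opmul S P m j) SP mulrCA.
move=> cL; rewrite -half //.
have cLt : opmul (optr L) S = opmul S (optr L).
  by have /(congr1 (@optr _ _)) := cL; rewrite !optrM symS.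
rewrite opmulA; have /(congr1 (@optr _ _)) := half _ cLt; rewrite !optrM symP; exact.
Qed.

(** * Matrix units acting on one tensor factor *)

Section Sites.
Variables (R : realType) (n d : nat).
Implicit Types (u v w : mi n d) (k l : 'I_n) (x y : 'I_d) (J : mi n d -> mi n d -> R).

Definition upd u k x : mi n d := [ffun l => if l == k then x else u l].

Lemma upd_eq u k x : upd u k x k = x.
Proof. by rewrite ffunE eqxx. Qed.

Lemma upd_neq u k x l : l != k -> upd u k x l = u l.
Proof. by move=> /negPf h; rewrite ffunE h. Qed.

Lemma upd_id u k : upd u k (u k) = u.
Proof. by apply/ffunP => l; rewrite ffunE; case: eqP => // ->. Qed.

Lemma upd_upd u k x y : upd (upd u k x) k y = upd u k y.
Proof. by apply/ffunP => l; rewrite !ffunE; case: (eqVneq l k). Qed.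

Lemma updC u k l x y : k != l -> upd (upd u k x) l y = upd (upd u l y) k x.
Proof.
move=> kl; apply/ffunP => m; rewrite !ffunE.
by case: (eqVneq m l) => // ->; rewrite eq_sym (negPf kl).
Qed.

(** This is |x><y| on factor [k], tensored with the identity on the other factors. *)
Definition unit_at k x y : mi n d -> mi n d -> R :=
  fun u v => ((u k == x) && (v == upd u k y))%:R.

Lemma unit_atC k x y u v : unit_at k x y u v = unit_at k y x v u.
Proof.
rewrite /unit_at; congr (_%:R); congr nat_of_bool; apply/andP/andP => -[/eqP h1 /eqP h2].
  by rewrite h2 upd_eq upd_upd -h1 upd_id !eqxx.
by rewrite h2 upd_eq upd_upd -h1 upd_id !eqxx.
Qed.

Lemma unit_at_mull k x y J u v :
  opmul (unit_at k x y) J u v = (u k == x)%:R * J (upd u k y) v.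
Proof.
rewrite /opmul (bigD1 (upd u k y)) //= /unit_at eqxx andbT big1 ?addr0 // => w /negPf ->.
by rewrite andbF mul0r.
Qed.

Lemma unit_at_mulr k x y J u v :
  opmul J (unit_at k x y) u v = (v k == y)%:R * J u (upd v k x).
Proof.
rewrite /opmul; under eq_bigr do rewrite unit_atC /unit_at.
rewrite (bigD1 (upd v k x)) //= eqxx andbT big1 ?addr0 => [|w /negPf ->].
  by rewrite mulrC.
by rewrite andbF mulr0.
Qed.

End Sites.
Arguments unit_at {R n d} k x y.

(** * Covariance of the operators omega_(0,i) *)

Section Covariance.
Variables (R : realType) (N d : nat).
Local Notation I := (mi N.+1 d).
Implicit Types (J : I -> I -> R).

(* the action of the matrix unit E_xy of gl_d on (C^d)^* \otimes (C^d)^{\otimes N} *)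
Definition gl_action x y : I -> I -> R :=
  fun u v => \sum_(i < N) unit_at (lift ord0 i) x y u v - unit_at ord0 y x u v.

(** Infinitesimal form of commutation with conj(U) on factor 0 and U on each output; the matrix
    units span gl_d. *)
Definition covariant J := forall x y, opmul (gl_action x y) J = opmul J (gl_action x y).

Lemma gl_action_mull x y J u v : opmul (gl_action x y) J u v =
  \sum_(i < N) opmul (unit_at (lift ord0 i) x y) J u v - opmul (unit_at ord0 y x) J u v.
Proof.
rewrite {2}/opmul exchange_big -sumrB; apply: eq_bigr => w _.
by rewrite mulrBl mulr_suml.
Qed.

Lemma gl_action_mulr x y J u v : opmul J (gl_action x y) u v =
  \sum_(i < N) opmul J (unit_at (lift ord0 i) x y) u v - opmul J (unit_at ord0 y x) u v.
Proof.
rewrite {2}/opmul exchange_big -sumrB; apply: eq_bigr => w _.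
by rewrite mulrBr mulr_sumr.
Qed.

Lemma omegaP (i : 'I_N) (u v : I) :
  reflect [/\ u ord0 = u (lift ord0 i), v ord0 = v (lift ord0 i) &
     forall k, k != ord0 -> k != lift ord0 i -> u k = v k]
   ((u ord0 == u (lift ord0 i)) && (v ord0 == v (lift ord0 i)) &&
   [forall k : 'I_N.+1, (k != ord0) && (k != lift ord0 i) ==> (u k == v k)]).
Proof.
apply: (iffP andP) => [[/andP[/eqP -> /eqP ->] /forallP h]|[-> -> h]]; split=> //.
- by move=> k k0 ki; have := h k; rewrite k0 ki => /eqP.
- by rewrite !eqxx.
- by apply/forallP => k; apply/implyP => /andP[k0 ki]; apply/eqP/h.
Qed.

Lemma omega_sym (i : 'I_N) (u v : I) : omega_0i d i u v = omega_0i d i v u :> R.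
Proof.
rewrite /omega_0i; congr (_%:R); congr nat_of_bool.
by apply/omegaP/omegaP => -[-> -> h]; split=> // k k0 ki; rewrite h.
Qed.

Lemma omega_unit_at (i : 'I_N) (l : 'I_N.+1) x y : l != ord0 -> l != lift ord0 i ->
  opmul (unit_at l x y) (omega_0i d i) = opmul (omega_0i d i) (unit_at l x y) :> (I -> I -> R).
Proof.
move=> l0 li; apply/funext => u; apply/funext => v.
rewrite unit_at_mull unit_at_mulr /omega_0i -!natrM !mulnb; congr (_%:R); congr nat_of_bool.
have l0' : ord0 != l by rewrite eq_sym.
have li' : lift ord0 i != l by rewrite eq_sym.
apply/andP/andP => -[/eqP h /omegaP [e1 e2 e3]]; rewrite ?upd_neq // in e1 e2.
  split; first by have := e3 l l0 li; rewrite upd_eq => <-.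
  apply/omegaP; rewrite !upd_neq //; split=> // k k0 ki.
  have [->|kl] := eqVneq k l; first by rewrite upd_eq.
  by rewrite upd_neq // -(e3 k) // upd_neq.
split; first by have := e3 l l0 li; rewrite upd_eq => ->.
apply/omegaP; rewrite !upd_neq //; split=> // k k0 ki.
have [->|kl] := eqVneq k l; first by rewrite upd_eq.
by rewrite upd_neq // (e3 k) // upd_neq.
Qed.

(* (A \otimes 1) Omega = (1 \otimes A^T) Omega *)
Lemma omega_transpose (i : 'I_N) x y :
  opmul (unit_at (lift ord0 i) x y) (omega_0i d i) =
  opmul (unit_at ord0 y x) (omega_0i d i) :> (I -> I -> R).
Proof.
have i0 : ord0 != lift ord0 i by [].
have i0' : lift ord0 i != ord0 by [].
apply/funext => u; apply/funext => v.
rewrite !unit_at_mull /omega_0i -!natrM !mulnb; congr (_%:R); congr nat_of_bool.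
apply/andP/andP => -[/eqP h /omegaP [e1 e2 e3]]; rewrite upd_eq upd_neq // in e1.
  split; first exact/eqP.
  apply/omegaP; rewrite upd_eq upd_neq //; split=> // k k0 ki.
  by rewrite upd_neq // -e3 // upd_neq.
split; first exact/eqP/esym.
apply/omegaP; rewrite upd_eq upd_neq //; split=> // k k0 ki.
by rewrite upd_neq // -e3 // upd_neq.
Qed.

Lemma opmul_sym_comm (A B C : I -> I -> R) : optr B = B ->
  opmul A B = opmul C B -> opmul B (optr A) = opmul B (optr C).
Proof. by move=> sB /(congr1 (@optr _ _)); rewrite !optrM sB. Qed.

(** The actions on factors 0 and i cancel against Omega, on the left by [omega_transpose] and on the
    right by its transpose; the action on every other factor commutes with omega_(0,i). *)
Lemma omega_covariant (i : 'I_N) : covariant (omega_0i d i).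
Proof.
move=> x y; apply/funext => u; apply/funext => v.
rewrite gl_action_mull gl_action_mulr (bigD1 i) // [in RHS](bigD1 i) //=.
rewrite omega_transpose addrAC subrr add0r.
have -> : opmul (omega_0i d i) (unit_at (lift ord0 i) x y) =
          opmul (omega_0i d i) (unit_at ord0 y x) :> (I -> I -> R).
  have tr_unit k a b : unit_at k a b = optr (unit_at k b a) :> (I -> I -> R).
    by apply/funext => ?; apply/funext => ?; rewrite unit_atC.
  rewrite tr_unit [in RHS]tr_unit; apply: opmul_sym_comm; last exact: omega_transpose.
  by apply/funext => ?; apply/funext => ?; exact: omega_sym.
rewrite addrAC subrr add0r; apply: eq_bigr => j ji.
by rewrite omega_unit_at // (inj_eq lift_inj).
Qed.

End Covariance.
Arguments gl_action {R N d} x y.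

(** * Two-site marginals *)

Section Marginals.
Variables (R : realType) (N d : nat).
Local Notation I := (mi N.+1 d).
Variable (s : 'I_N).
Implicit Types (J : I -> I -> R) (u v : I).
Local Notation t := (lift ord0 s).

Definition upd2 u (c b : 'I_d) : I := upd (upd u ord0 c) t b.

(* the entry <c, a| X |c', b> of the reduction X of J to the factors 0 and t *)
Definition marginal2 J (c a c' b : 'I_d) : R :=
  \sum_(u : I | (u ord0 == c) && (u t == a)) J u (upd2 u c' b).

Let t0 : t != ord0. Proof. by []. Qed.
Let t0' : ord0 != t. Proof. by []. Qed.

Let upd2_t u c b : upd2 u c b t = b. Proof. exact: upd_eq. Qed.
Let upd2_0 u c b : upd2 u c b ord0 = c. Proof. by rewrite upd_neq // upd_eq. Qed.

Lemma marginal2_sub J J' c a c' b :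
  marginal2 (fun u v => J u v - J' u v) c a c' b = marginal2 J c a c' b - marginal2 J' c a c' b.
Proof. by rewrite /marginal2 sumrB. Qed.

Lemma marginal2_sum (K : finType) (P : pred K) (J : K -> I -> I -> R) c a c' b :
  marginal2 (fun u v => \sum_(k | P k) J k u v) c a c' b = \sum_(k | P k) marginal2 (J k) c a c' b.
Proof. by rewrite /marginal2 exchange_big. Qed.

(** Cyclicity of the trace over factor [l]: the reindexing exchanges the values [x] and [y]
    there. *)
Lemma marginal2_traced J (l : 'I_N.+1) x y c a c' b : l != ord0 -> l != t ->
  marginal2 (opmul (unit_at l x y) J) c a c' b = marginal2 (opmul J (unit_at l x y)) c a c' b.
Proof.
move=> l0 lt; rewrite /marginal2.
have l0' : ord0 != l by rewrite eq_sym.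
have lt' : t != l by rewrite eq_sym.
under eq_bigr do rewrite unit_at_mull mulr_natl mulrb.
under [RHS]eq_bigr do rewrite unit_at_mulr mulr_natl mulrb.
rewrite -!big_mkcondr /=.
rewrite (reindex_onto (fun u => upd u l x) (fun u => upd u l y)) /=; last first.
  by move=> u /andP[_ /eqP <-]; rewrite upd_upd upd_id.
apply: eq_big => u.
  rewrite upd_upd upd_eq !upd_neq // eqxx andbT; congr andb.
  apply/eqP/eqP => [<-|<-]; last exact: upd_id.
  by rewrite upd_eq.
move=> /andP[_ /eqP uy]; rewrite {1}uy; congr J.
by rewrite /upd2 (updC _ _ _ l0) (updC _ _ _ lt).
Qed.

Lemma marginal2_mull_out J x y c a c' b :
  marginal2 (opmul (unit_at t x y) J) c a c' b = (a == x)%:R * marginal2 J c y c' b.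
Proof.
rewrite /marginal2 mulr_sumr [RHS](reindex_onto (fun u => upd u t y) (fun u => upd u t a)) /=; last first.
  by move=> u /andP[_ /eqP <-]; rewrite upd_upd upd_id.
apply: eq_big => u.
  rewrite upd_upd upd_eq !upd_neq // eqxx andbT; congr andb.
  apply/eqP/eqP => [<-|<-]; first exact: upd_id.
  by rewrite upd_eq.
move=> /andP[_ /eqP <-]; rewrite unit_at_mull; congr (_ * J _ _).
by rewrite /upd2 (updC _ _ _ t0) upd_upd.
Qed.

Lemma marginal2_mulr_out J x y c a c' b :
  marginal2 (opmul J (unit_at t x y)) c a c' b = (b == y)%:R * marginal2 J c a c' x.
Proof.
rewrite /marginal2 mulr_sumr; apply: eq_bigr => u _.
by rewrite unit_at_mulr upd2_t /upd2 upd_upd.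
Qed.

Lemma marginal2_mull_in J x y c a c' b :
  marginal2 (opmul (unit_at ord0 x y) J) c a c' b = (c == x)%:R * marginal2 J y a c' b.
Proof.
rewrite /marginal2 mulr_sumr [RHS](reindex_onto (fun u => upd u ord0 y) (fun u => upd u ord0 c)) /=; last first.
  by move=> u /andP[/eqP <- _]; rewrite upd_upd upd_id.
apply: eq_big => u.
  rewrite upd_upd upd_eq upd_neq // eqxx /= andbC; congr andb.
  apply/eqP/eqP => [<-|<-]; first exact: upd_id.
  by rewrite upd_eq.
move=> /andP[/eqP <- _]; rewrite unit_at_mull; congr (_ * J _ _).
by rewrite /upd2 upd_upd.
Qed.

Lemma marginal2_mulr_in J x y c a c' b :
  marginal2 (opmul J (unit_at ord0 x y)) c a c' b = (c' == y)%:R * marginal2 J c a x b.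
Proof.
rewrite /marginal2 mulr_sumr; apply: eq_bigr => u _.
by rewrite unit_at_mulr upd2_0 /upd2 updC // upd_upd updC.
Qed.

(** Reducing the covariance identity to factors 0 and t, the terms acting on traced-out factors
    cancel by [marginal2_traced]. *)
Lemma marginal2_covariant J : covariant J -> forall x y c a c' b,
  (a == x)%:R * marginal2 J c y c' b - (c == y)%:R * marginal2 J x a c' b =
  (b == y)%:R * marginal2 J c a c' x - (c' == x)%:R * marginal2 J c a y b.
Proof.
move=> covJ x y c a c' b.
have := congr1 (fun A => marginal2 A c a c' b) (covJ x y).
have -> : opmul (@gl_action R N d x y) J = fun u v => \sum_(i < N) opmul (unit_at (lift ord0 i) x y) J u v - opmul (unit_at ord0 y x) J u v.
  by apply/funext => u; apply/funext => v; exact: gl_action_mull.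
have -> : opmul J (@gl_action R N d x y) = fun u v => \sum_(i < N) opmul J (unit_at (lift ord0 i) x y) u v - opmul J (unit_at ord0 y x) u v.
  by apply/funext => u; apply/funext => v; exact: gl_action_mulr.
rewrite (marginal2_sub _ (opmul (unit_at ord0 y x) J)) (marginal2_sub _ (opmul J (unit_at ord0 y x))).
rewrite (marginal2_sum _ (fun i => opmul (unit_at (lift ord0 i) x y) J)).
rewrite (marginal2_sum _ (fun i => opmul J (unit_at (lift ord0 i) x y))).
rewrite (bigD1 s) //= [in X in _ = X](bigD1 s) //=.
rewrite marginal2_mull_out marginal2_mull_in marginal2_mulr_out marginal2_mulr_in.
under eq_bigr => i is_ do rewrite marginal2_traced //.
by move=> H; apply: (addIr (\sum_(i < N | i != s) marginal2 (opmul J (unit_at (lift ord0 i) x y)) c a c' b)); rewrite addrAC H addrAC.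
Qed.

Lemma marginal2_trace J : \sum_c \sum_a marginal2 J c a c a = \sum_u J u u.
Proof.
rewrite [RHS](partition_big (fun u : I => u ord0) xpredT) //=; apply: eq_bigr => c _.
rewrite [RHS](partition_big (fun u : I => u t) xpredT) //=; apply: eq_bigr => a _.
apply: eq_bigr => u /andP[/eqP <- /eqP <-]; congr (J u _).
by rewrite /upd2 upd_id upd_id.
Qed.

Lemma marginal2_omega J :
  \sum_c \sum_c' marginal2 J c c c' c' = \sum_u \sum_v J u v * omega_0i d s u v.
Proof.
have -> : \sum_c \sum_c' marginal2 J c c c' c' = \sum_(u : I | u ord0 == u t) \sum_c J u (upd2 u c c).
  rewrite [RHS](partition_big (fun u : I => u ord0) xpredT) //=; apply: eq_bigr => c _.
  rewrite exchange_big /=; apply: eq_bigl => u.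
  by case: eqVneq => [->|]; rewrite ?andbT ?andbF // eq_sym.
rewrite big_mkcond /=; apply: eq_bigr => u _; case: ifP => u0t; last first.
  by rewrite big1 // => v _; rewrite /omega_0i u0t mulr0.
(* For fixed [u], an index [v] with nonzero omega entry is determined by its common value on factors
   0 and t. *)
rewrite (bigID (fun v : I => v == upd2 u (v ord0) (v ord0))) /= [X in _ + X]big1 ?addr0; last first.
  move=> v /eqP nv; rewrite /omega_0i; case: omegaP => [[e1 e2 e3]|]; last by rewrite mulr0.
  case: nv; apply/ffunP => k; have [->|k0] := eqVneq k ord0; first by rewrite upd2_0.
  have [->|kt] := eqVneq k t; first by rewrite upd2_t.
  by rewrite /upd2 !upd_neq // e3.
rewrite (reindex_onto (fun c => upd2 u c c) (fun v : I => v ord0)) /=; last by move=> v /eqP.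
apply: eq_big => c; first by rewrite upd2_0 !eqxx.
move=> _; rewrite /omega_0i; case: omegaP => [_|[]]; first by rewrite mulr1.
split; [exact/eqP | by rewrite upd2_0 upd2_t|].
by move=> k k0 kt; rewrite /upd2 !upd_neq.
Qed.

End Marginals.

(* Schur's lemma for the representation (C^d)^* \otimes C^d of gl_d *)
Lemma gl_invariant_span (R : realFieldType) (d : nat) (X : 'I_d -> 'I_d -> 'I_d -> 'I_d -> R) :
  (1 < d)%N ->
  (forall x y c a c' b,
  (a == x)%:R * X c y c' b - (c == y)%:R * X x a c' b =
  (b == y)%:R * X c a c' x - (c' == x)%:R * X c a y b) ->
  exists al be, forall c a c' b,
    X c a c' b = al * ((c == c') && (a == b))%:R + be * ((c == a) && (c' == b))%:R.
Proof.
move=> d1 H.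
(* Weight argument: the diagonal units x = y = t force the index pairs {a, c'} and {c, b} to agree
   with multiplicity wherever [X] is nonzero. *)
have off c a c' b : ~~ ((c == c') && (a == b)) -> ~~ ((c == a) && (c' == b)) -> X c a c' b = 0.
  have Ht t : (a == t)%:R * X c a c' b - (c == t)%:R * X c a c' b =
              (b == t)%:R * X c a c' b - (c' == t)%:R * X c a c' b.
    have := H t t c a c' b.
    by case: (eqVneq a t) => [->|_]; case: (eqVneq c t) => [->|_];
       case: (eqVneq b t) => [->|_]; case: (eqVneq c' t) => [->|_]; rewrite ?mul0r.
  have [eab|nab] := eqVneq a b.
    rewrite andbT => /negPf nc _; have := Ht c.
    by rewrite eqxx -eab [c' == c]eq_sym nc ?mul1r ?mul0r; lra.
  have [eca|nca] := eqVneq c a => _ /= nc.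
    have := Ht b; rewrite eqxx -eca (negPf nc).
    by rewrite eca ?mul1r ?mul0r; lra.
  have := Ht a; rewrite eqxx (negPf nca) [b == a]eq_sym (negPf nab).
  by case: eqP => _; rewrite ?mul1r ?mul0r; lra.
(* [D] and [W] are the surviving entries; the off-diagonal units show that each is constant off its
   diagonal. *)
pose D c a := X c a c a; pose W c c' := X c c c' c'.
have E1 c x y : x != y -> c != x -> c != y -> D c y = D c x.
  by move=> xy cx cy; have := H x y c x c y; rewrite !eqxx (negPf cx) (negPf cy) /D ?mul1r ?mul0r; lra.
have E2 x y : x != y -> X x x x x = D x y + W x y.
  by move=> xy; have := H x y x x x y; rewrite !eqxx (negPf xy) /D /W ?mul1r ?mul0r; lra.
have E3 x y : x != y -> X y y y y = D y x + W x y.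
  by move=> xy; have := H x y y x y y; rewrite !eqxx [y == x]eq_sym (negPf xy) /D /W ?mul1r ?mul0r; lra.
have E4 x y : x != y -> X y y y y = D x y + W y x.
  by move=> xy; have := H x y y y x y; rewrite !eqxx [y == x]eq_sym (negPf xy) /D /W ?mul1r ?mul0r; lra.
have Wsym x y : x != y -> W x y = W y x.
  by move=> xy; have yx := xy; rewrite eq_sym in yx; have := E2 _ _ xy; have := E3 _ _ yx; lra.
have Dsym x y : x != y -> D x y = D y x.
  by move=> xy; have := E3 _ _ xy; have := E4 _ _ xy; rewrite (Wsym _ _ xy); lra.
have D2 x y y' : x != y -> x != y' -> D x y = D x y'.
  by move=> xy xy'; have [->//|nyy] := eqVneq y' y; apply: E1.
have W2 x y y' : x != y -> x != y' -> W x y = W x y'.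
  by move=> xy xy'; have := E2 _ _ xy; rewrite (E2 _ _ xy') (D2 _ _ _ xy xy'); lra.
have const (f : 'I_d -> 'I_d -> R) : (forall x y, x != y -> f x y = f y x) ->
    (forall x y y', x != y -> x != y' -> f x y = f x y') ->
    forall x y x' y', x != y -> x' != y' -> f x y = f x' y'.
  move=> fs f2 x y x' y' xy xy'; rewrite (fs x') //; have [e|ne] := eqVneq x y'.
    by rewrite -e; apply: f2 => //; rewrite e eq_sym.
  rewrite (f2 x y y') // fs //; apply: f2; by rewrite eq_sym.
pose i0 : 'I_d := Ordinal (ltnW d1); pose i1 : 'I_d := Ordinal d1.
have i01 : i0 != i1 by [].
have Dc x y : x != y -> D x y = D i0 i1 by move=> xy; apply: const.
have Wc x y : x != y -> W x y = W i0 i1 by move=> xy; apply: const.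
exists (D i0 i1), (W i0 i1) => c a c' b.
have [/andP[/eqP <- /eqP <-]|h1] := boolP (_ && _).
  (* When all four indices agree, both deltas equal 1, and [E2] with some y != a splits the entry as
     al + be. *)
  have [->|ca] := eqVneq c a; last by rewrite mulr1 mulr0 addr0; apply: Dc.
  rewrite !mulr1.
  have [y ay] : exists y, a != y.
    by have [->|?] := eqVneq a i0; [exists i1|exists i0].
  by rewrite (E2 _ _ ay) (Dc _ _ ay) (Wc _ _ ay).
have [/andP[/eqP e1 /eqP e2]|h2] := boolP (_ && _); last by rewrite off // !mulr0 addr0.
move: h1; rewrite -e1 -e2 andbb => h1; rewrite mulr0 add0r mulr1.
exact: Wc.
Qed.

(** * Covariant Choi operators *)

(** Trace preservation enters through the single equation Tr J = d; Schur's lemma later turns it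
    into the full partial-trace condition. *)
Record covariant_choi (R : realType) (N d : nat) (J : mi N.+1 d -> mi N.+1 d -> R) : Prop :=
  CovariantChoi {
    choi_sym : forall u v, J u v = J v u;
    choi_psd : forall x : mi N.+1 d -> R, 0 <= \sum_u \sum_v x u * J u v * x v;
    choi_trace : \sum_u J u u = d%:R;
    choi_covariant : covariant J }.

Section Feasible.
Variables (R : realType) (N d : nat).
Local Notation I := (mi N.+1 d).
Implicit Types (J : I -> I -> R).

(* Tr[J omega_(0,i)], as omega is symmetric *)
Definition fidelity J (i : 'I_N) := \sum_u \sum_v J u v * omega_0i d i u v.

Lemma covariant_choi_closed_convex :
  closed_convex (fun y : I * I -> R => covariant_choi (fun u v => y (u, v))).
Proof.
(* The conditions are restated as a family of linear equations and inequalities in the entries. *)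
pose F (y : I * I -> R) := (forall u v, y (u, v) - y (v, u) = 0) /\
  ((forall x : I -> R, 0 <= \sum_u \sum_v x u * y (u, v) * x v) /\
  ((\sum_u y (u, u) = d%:R) /\
   (forall x z u v, \sum_k gl_action x z u k * y (k, v) - \sum_k y (u, k) * gl_action x z k v = 0))).
have FE y : covariant_choi (fun u v => y (u, v)) <-> F y.
  split=> [[h1 h2 h3 h4]|[h1 [h2 [h3 h4]]]].
    split=> [u v|]; first by rewrite h1 subrr.
    split=> //; split=> // x z u v.
    by have := congr1 (fun A => A u v) (h4 x z); rewrite /opmul => ->; rewrite subrr.
  split=> // [u v|x z]; first by apply/eqP; rewrite -subr_eq0 h1.
  apply/funext => u; apply/funext => v; apply/eqP; rewrite -subr_eq0; apply/eqP; exact: h4.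
have cF : closed_convex F.
  apply: closed_convex_and.
    apply: closed_convex_forall => u; apply: closed_convex_forall => v.
    by apply: closed_convex_eq; apply: linear_functional_sub; apply: linear_functional_coord.
  apply: closed_convex_and.
    apply: closed_convex_forall => x; apply: closed_convex_ge.
    apply: linear_functional_sum => u; apply: linear_functional_sum => v; apply: linear_functional_scaler.
    by apply: linear_functional_scale; apply: linear_functional_coord.
  apply: closed_convex_and.
    by apply: closed_convex_eq; apply: linear_functional_sum => u; apply: linear_functional_coord.
  do 4! (apply: closed_convex_forall => ?); apply: closed_convex_eq; apply: linear_functional_sub.
    by apply: linear_functional_sum => u; apply: linear_functional_scale; apply: linear_functional_coord.
  by apply: linear_functional_sum => u; apply: linear_functional_scaler; apply: linear_functional_coord.
move=> y H; apply/FE/cF => a b h; apply: H => z /FE; exact: h.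
Qed.

(** Testing on e_u + e_v and e_u - e_v bounds |A u v| by the mean of two diagonal entries. This
    supplies the boundedness behind compactness. *)
Lemma psd_entry_le (I' : finType) (A : I' -> I' -> R) :
  (forall u v, A u v = A v u) ->
  (forall x : I' -> R, 0 <= \sum_u \sum_v x u * A u v * x v) ->
  forall u v, `|A u v| <= \sum_w A w w.
Proof.
move=> symA psdA.
have Q s u v : 0 <= A u u + s * A u v + s * (A v u + s * A v v).
  have := psdA (fun w => (w == u)%:R + s * (w == v)%:R).
  have lin (G : I' -> R) : \sum_w ((w == u)%:R + s * (w == v)%:R) * G w = G u + s * G v.
    under eq_bigr do rewrite mulrDl -mulrA.
    by rewrite big_split -mulr_sumr /= !sum_deltal.
  under eq_bigr => a _.
    under eq_bigr => b _ do rewrite -mulrA [A a b * _]mulrC.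
    rewrite -mulr_sumr lin.
  over.
  by rewrite lin.
have A0 u : 0 <= A u u by have := Q 0 u u; rewrite !mul0r !addr0.
have Atr u : A u u <= \sum_w A w w by rewrite (bigD1 u) //= lerDl; apply: sumr_ge0.
move=> u v; have := Q 1 u v; have := Q (-1) u v; rewrite (symA v u).
have := Atr u; have := Atr v; rewrite ler_norml => h1 h2 h3 h4.
by apply/andP; split; lra.
Qed.

(** Commuting with all matrix units on output i makes the reduction a product with the identity
    there. The fidelity is then the part of the trace with output index [a], the same for each of
    the d values of [a]. *)
Lemma fidelity_trivial_output J i : (forall x y,
  opmul (unit_at (lift ord0 i) x y) J = opmul J (unit_at (lift ord0 i) x y)) ->
  d%:R * fidelity J i = \sum_u J u u.
Proof.
move=> cJ.
have M y c c' b a : marginal2 i J c y c' b = (b == y)%:R * marginal2 i J c a c' a.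
  have := congr1 (fun A => marginal2 i A c a c' b) (cJ a y).
  by rewrite marginal2_mull_out marginal2_mulr_out eqxx mul1r.
have f a : fidelity J i = \sum_c marginal2 i J c a c a.
  rewrite /fidelity -marginal2_omega; apply: eq_bigr => c _.
  under eq_bigr => c' _ do rewrite (M _ _ _ _ a).
  by rewrite sum_deltal.
rewrite -(marginal2_trace i) exchange_big /=.
rewrite -[d in LHS]card_ord mulr_natl -sumr_const.
by apply: eq_bigr => a _; apply: f.
Qed.

Lemma S_op_sym (x : 'I_N -> R) (u v : I) : S_op d x u v = S_op d x v u.
Proof. by apply: eq_bigr => i _; rewrite omega_sym. Qed.

(** Restricting to nonzero weights lets [L] act on an output whose weight vanishes. *)
Lemma S_op_comm (x : 'I_N -> R) (L : I -> I -> R) :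
  (forall i, x i != 0 -> opmul L (omega_0i d i) = opmul (omega_0i d i) L) ->
  opmul L (S_op d x) = opmul (S_op d x) L.
Proof.
move=> cL; apply/funext => u; apply/funext => v; rewrite /opmul /S_op.
under eq_bigr do rewrite mulr_sumr.
under [RHS]eq_bigr do rewrite mulr_suml.
rewrite exchange_big [RHS]exchange_big; apply: eq_bigr => i _ /=.
have [->|xi] := eqVneq (x i) 0.
  by rewrite normr0 !big1 // => k _; rewrite !mul0r ?mulr0.
have := congr1 (fun A => `|x i| * A u v) (cL i xi); rewrite /opmul !mulr_sumr => H.
under eq_bigr do rewrite mulrCA.
by rewrite H; apply: eq_bigr => k _; rewrite mulrA.
Qed.

Lemma covariant_choi_maximizer (x : 'I_N -> R) : (0 < d)%N -> (forall i, 0 <= x i) ->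
  exists J, [/\ covariant_choi J,
    \sum_i x i * fidelity J i = d%:R * lambda_max (S_op d x)
    & forall i, x i = 0 -> fidelity J i = 1].
Proof.
move=> d0 x0; set S := S_op d x.
have i0 : I := [ffun=> Ordinal d0].
have symS u v : S u v = S v u by exact: S_op_sym.
have [w [m [ow cw dS]]] := real_symmetric_spectral symS.
have [P [symP SP fixP]] := top_eigenprojection symS ow cw dS.
have [[k mk] _] := lambda_max_spectrum symS ow cw dS i0.
set l := lambda_max S in SP fixP mk *.
(* The columns of [P] are top eigenvectors, hence fixed by [P]. *)
have PP u v : \sum_k P u k * P k v = P u v by apply: (fixP (fun k => P k v)) => ?; exact: SP.
have := spectrum_is_eigenvalue ow dS k; rewrite mk => -[z [[j zj] Sz]].
have trP : \sum_u P u u = \sum_u \sum_v P u v ^+ 2.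
  by apply: eq_bigr => u _; rewrite -PP; apply: eq_bigr => v _; rewrite expr2 [P v u]symP.
set t := \sum_u P u u in trP.
(* If the trace, a sum of squares, vanished, then P = 0 could not fix the eigenvector [z]. *)
have t0 : 0 < t.
  rewrite lt_def trP; apply/andP; split; last first.
    by apply: sumr_ge0 => u _; apply: sumr_ge0 => v _; apply: sqr_ge0.
  apply: contra zj => /eqP H0; rewrite -fixP // big1 // => v _.
  have : \sum_v P j v ^+ 2 = 0.
    apply/eqP; move/eqP: H0; rewrite psumr_eq0 => [/allP /(_ j)|u _].
      by rewrite mem_index_enum => /(_ isT).
    by apply: sumr_ge0 => ? _; apply: sqr_ge0.
  move/eqP; rewrite psumr_eq0 => [/allP /(_ v)|? _]; last exact: sqr_ge0.
  by rewrite mem_index_enum sqrf_eq0 => /(_ isT) /eqP ->; rewrite mul0r.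
have comm L : (forall i, x i != 0 -> opmul L (omega_0i d i) = opmul (omega_0i d i) L) ->
    opmul L P = opmul P L.
  move=> cL; apply: (@eigenprojection_commutes _ _ S _ _ l) => //.
  - by apply/funext => ?; apply/funext => ?; exact: symS.
  - by apply/funext => ?; apply/funext => ?; exact: symP.
  - exact: S_op_comm.
pose c := d%:R / t; have c0 : 0 <= c by rewrite divr_ge0 // ltW.
have ct : c * t = d%:R by rewrite /c divfK // gt_eqF.
pose J u v := c * P u v.
have commJ L : opmul L P = opmul P L -> opmul L J = opmul J L.
  move=> cL; apply/funext => u; apply/funext => v.
  have := congr1 (fun A => c * A u v) cL; rewrite /opmul !mulr_sumr => H.
  under eq_bigr do rewrite mulrCA.
  by rewrite H; apply: eq_bigr => ? _; rewrite mulrA.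
have trJ : \sum_u J u u = d%:R by rewrite -ct /t mulr_sumr.
exists J; split.
- split=> //.
  + by move=> u v; rewrite /J symP.
  + move=> y.
    (* As [P] is a symmetric idempotent, the form at [y] is c |P y|^2. *)
    have -> : \sum_u \sum_v y u * J u v * y v = c * \sum_k (\sum_u P k u * y u) ^+ 2.
      have -> : \sum_k (\sum_u P k u * y u) ^+ 2 = \sum_k \sum_u \sum_v y u * (P u k * P k v) * y v.
        apply: eq_bigr => k' _; rewrite expr2 mulr_suml; apply: eq_bigr => u _.
        by rewrite mulr_sumr; apply: eq_bigr => v _; rewrite (symP u); ring.
      rewrite [X in _ = c * X]exchange_big mulr_sumr; apply: eq_bigr => u _.
      rewrite exchange_big mulr_sumr; apply: eq_bigr => v _.
      by rewrite -mulr_suml -mulr_sumr PP /J; ring.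
    by rewrite mulr_ge0 // sumr_ge0 // => ? _; exact: sqr_ge0.
  + by move=> a b; apply/commJ/comm => i _; exact: omega_covariant.
- have -> : \sum_i x i * fidelity J i = \sum_u \sum_v S u v * J v u.
    rewrite /fidelity; under eq_bigr do rewrite mulr_sumr.
    rewrite exchange_big; apply: eq_bigr => u _.
    under eq_bigr do rewrite mulr_sumr.
    rewrite exchange_big; apply: eq_bigr => v _.
    rewrite mulr_suml; apply: eq_bigr => i _.
    by rewrite ger0_norm // /J symP; ring.
  rewrite -trJ mulr_suml; apply: eq_bigr => u _.
  by rewrite /J; under eq_bigr do rewrite mulrCA; rewrite -mulr_sumr SP; ring.
- move=> i xi.
  have := @fidelity_trivial_output J i; rewrite trJ => H.
  have dn0 : d%:R != 0 :> R by rewrite pnatr_eq0 -lt0n.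
  apply: (mulfI dn0); rewrite mulr1; apply: H => a b; apply/commJ/comm => k' xk.
  apply: omega_unit_at => //.
  by apply: contra xk => /eqP /lift_inj <-; rewrite xi.
Qed.

Lemma covariant_choi_fidelity (p : 'I_N -> R) : (1 < d)%N -> (forall i, 0 <= p i) ->
  (forall x : 'I_N -> R, (exists i, x i != 0) -> \sum_i p i * x i <= Qnorm d x) ->
  exists2 J, covariant_choi J & forall i, fidelity J i = p i * (d%:R ^+ 2 - 1) + 1.
Proof.
move=> d1 p0 H.
pose q i := p i * (d%:R ^+ 2 - 1) + 1.
have d2 : 1 <= d%:R :> R by rewrite ler1n ltnW.
have d3 : 1 < d%:R :> R by rewrite ltr1n.
have D0 : 0 < (d%:R ^+ 2 - 1) :> R by nra.
have q1 i : 1 <= q i by rewrite /q lerDr mulr_ge0 // ltW.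
pose g i (e : I * I) : R := omega_0i d i e.1 e.2.
have fE (y : I * I -> R) i : \sum_e g i e * y e = fidelity (fun u v => y (u, v)) i.
  rewrite /fidelity pair_bigA; apply: eq_bigr => -[u v] _; exact: mulrC.
have [y Fy fy] : exists2 y : I * I -> R, covariant_choi (fun u v => y (u, v)) &
    forall i, \sum_e g i e * y e = q i; last first.
  by exists (fun u v => y (u, v)) => // i; rewrite -fE fy.
apply: (@compact_convex_solvable _ _ _ d%:R) => //.
- exact: covariant_choi_closed_convex.
- by move=> y [s1 s2 s3 s4] [u v]; rewrite -s3; exact: (psd_entry_le s1 s2).
move=> x; pose xp i := Num.max (x i) 0.
have xp0 i : 0 <= xp i by rewrite /xp le_max lexx orbT.
have [J [FJ JS J1]] := covariant_choi_maximizer (ltnW d1) xp0.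
exists (fun e => J e.1 e.2); first exact: FJ.
under [leRHS]eq_bigr do rewrite fE.
rewrite -subr_ge0 -sumrB.
(* Split off the positive part of [x]: where x_i < 0 the fidelity is 1 <= q_i, so the last sum is
   nonnegative. *)
have -> : \sum_i (x i * fidelity J i - x i * q i) =
  \sum_i xp i * fidelity J i - \sum_i xp i * q i + \sum_i (xp i - x i) * (q i - fidelity J i).
  by rewrite -sumrB -big_split; apply: eq_bigr => i _ /=; ring.
rewrite addr_ge0 //; last first.
  apply: sumr_ge0 => i _; rewrite /xp; have [x_lt|x_ge] := ltP (x i) 0; last by rewrite subrr mul0r.
  rewrite J1; first by rewrite mulr_ge0 // subr_ge0 // ltW.
  by rewrite /xp max_r // ltW.
rewrite subr_ge0.
(* The hypothesis covers nonzero vectors only; for zero positive part both sums vanish. *)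
have [/existsP nz|/existsPn z] := boolP [exists i, xp i != 0]; last first.
  by rewrite !big1 // => i _; have := z i; rewrite negbK => /eqP ->; rewrite mul0r.
rewrite JS; have := H xp nz; rewrite /Qnorm ler_pdivlMr // => Hx.
have -> : \sum_i xp i * q i = (\sum_i p i * xp i) * (d%:R ^+ 2 - 1) + norm1 xp.
  rewrite /norm1 mulr_suml -big_split; apply: eq_bigr => i _.
  by rewrite ger0_norm // /q /=; ring.
by rewrite -lerBrDr.
Qed.

End Feasible.

(** * Channels from Choi operators *)

Section Split.
Variables (N d : nat).

Definition mcons (a : 'I_d) (e : mi N d) : mi N.+1 d := [ffun k => oapp e a (unlift ord0 k)].

Lemma mcons0 a e : mcons a e ord0 = a.
Proof. by rewrite ffunE unlift_none. Qed.

Lemma mconsS a e i : mcons a e (lift ord0 i) = e i.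
Proof. by rewrite ffunE liftK. Qed.

Definition mtail (u : mi N.+1 d) : mi N d := [ffun i => u (lift ord0 i)].

Lemma mtailK (u : mi N.+1 d) : mcons (u ord0) (mtail u) = u.
Proof.
by apply/ffunP => k; rewrite ffunE; case: unliftP => [j ->|->] /=; rewrite ?ffunE.
Qed.

Lemma mconsK a e : mtail (mcons a e) = e.
Proof. by apply/ffunP => i; rewrite ffunE mconsS. Qed.

Lemma mcons_upd a e i b : mcons a (upd e i b) = upd (mcons a e) (lift ord0 i) b.
Proof.
apply/ffunP => k; rewrite !ffunE; case: unliftP => [j ->|->] /=; last by [].
by rewrite ffunE (inj_eq lift_inj).
Qed.

Lemma upd_mcons a e b : upd (mcons a e) ord0 b = mcons b e.
Proof. by apply/ffunP => k; rewrite !ffunE; case: unliftP => [j ->|->]. Qed.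

Lemma sum_mcons (V : nmodType) (c : 'I_d) (P : pred (mi N.+1 d)) (F : mi N.+1 d -> V) :
  \sum_(u : mi N.+1 d | (u ord0 == c) && P u) F u = \sum_(e | P (mcons c e)) F (mcons c e).
Proof.
rewrite (reindex_onto (mcons c) mtail) /=; last by move=> u /andP[/eqP <- _]; exact: mtailK.
by apply: eq_bigl => e; rewrite mcons0 mconsK !eqxx andbT.
Qed.

Lemma mcons_bij : bijective (fun x : 'I_d * mi N d => mcons x.1 x.2).
Proof.
exists (fun u : mi N.+1 d => (u ord0, mtail u)) => [[a e]|u] /=; last exact: mtailK.
by rewrite mcons0 mconsK.
Qed.

Lemma marginal2_mcons (R : realType) (J : mi N.+1 d -> mi N.+1 d -> R) i c a c' b :
  marginal2 i J c a c' b = \sum_(e : mi N d | e i == a) J (mcons c e) (mcons c' (upd e i b)).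
Proof.
rewrite /marginal2 (sum_mcons c (fun u : mi N.+1 d => u (lift ord0 i) == a)).
apply: eq_big => e; first by rewrite mconsS.
by move=> _; rewrite /upd2 upd_mcons mcons_upd.
Qed.

End Split.

Lemma sum_pair (V : nmodType) (A B : finType) (G : A * B -> V) :
  \sum_x G x = \sum_a \sum_b G (a, b).
Proof. by rewrite pair_bigA; apply: eq_bigr => -[]. Qed.

Section Psd.
Variable (R : realType).
Local Notation C := R[i].

Lemma psd_rank1 (I : finType) (g : I -> C) : psd (fun i j => g i * Num.conj (g j)).
Proof.
move=> v; have -> : \sum_i \sum_j Num.conj (v i) * (g i * Num.conj (g j)) * v j =
  (\sum_i Num.conj (v i) * g i) * Num.conj (\sum_i Num.conj (v i) * g i).
  rewrite rmorph_sum mulr_suml; apply: eq_bigr => i _.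
  rewrite mulr_sumr; apply: eq_bigr => j _.
  by rewrite rmorphM /= conjCK; ring.
exact: mul_conjC_ge0.
Qed.

Lemma psd_sum (I K : finType) (m : K -> R) (B : K -> op R I) :
  (forall k, 0 <= m k) -> (forall k, psd (B k)) ->
  psd (fun i j => \sum_k (m k)%:C * B k i j).
Proof.
move=> m0 pB v.
have -> : \sum_i \sum_j Num.conj (v i) * (\sum_k (m k)%:C * B k i j) * v j =
  \sum_k (m k)%:C * \sum_i \sum_j Num.conj (v i) * B k i j * v j.
  under [RHS]eq_bigr do rewrite mulr_sumr.
  rewrite [RHS]exchange_big; apply: eq_bigr => i _.
  under [RHS]eq_bigr do rewrite mulr_sumr.
  rewrite [RHS]exchange_big; apply: eq_bigr => j _.
  rewrite mulr_sumr mulr_suml; apply: eq_bigr => k _; ring.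
by apply: sumr_ge0 => k _; rewrite mulr_ge0 // ?lecR //; exact: pB.
Qed.

Lemma psd_bij (I I' : finType) (f : I' -> I) (B : op R I) : bijective f ->
  psd (fun i j => B (f i) (f j)) -> psd B.
Proof.
move=> bf H v; rewrite (reindex f); last exact: onW_bij.
have := H (fun i => v (f i)); congr (0 <= _); apply: eq_bigr => i _.
by rewrite [RHS](reindex f) //; exact: onW_bij.
Qed.

(** Positivity is tested on real vectors only, which suffices because each [m k] has a real
    eigenvector. *)
Lemma real_psd_decomposition (I : finType) (J : I -> I -> R) :
  (forall u v, J u v = J v u) ->
  (forall x : I -> R, 0 <= \sum_u \sum_v x u * J u v * x v) ->
  exists (w : 'I_#|I| -> I -> C) (m : 'I_#|I| -> R), (forall k, 0 <= m k) /\
    forall u v, (J u v)%:C = \sum_k (m k)%:C * (w k u * Num.conj (w k v)).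
Proof.
move=> symJ psdJ; have [w [m [ow cw dJ]]] := real_symmetric_spectral symJ.
exists w, m; split=> // k.
have [x [[i xi] Jx]] := spectrum_is_eigenvalue ow dJ k.
have := psdJ x.
have -> : \sum_u \sum_v x u * J u v * x v = m k * \sum_u x u ^+ 2.
  rewrite mulr_sumr; apply: eq_bigr => u _.
  by under eq_bigr do rewrite -mulrA; rewrite -mulr_sumr Jx; ring.
rewrite pmulr_lge0 // lt_def; apply/andP; split; last first.
  by apply: sumr_ge0 => ? _; exact: sqr_ge0.
apply: contra xi; rewrite psumr_eq0 => [/allP /(_ i)|? _]; last exact: sqr_ge0.
by rewrite mem_index_enum sqrf_eq0 => /(_ isT).
Qed.

End Psd.

Section Channel.
Variables (R : realType) (N d : nat).
Local Notation C := R[i].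
Variable (J : mi N.+1 d -> mi N.+1 d -> R).

(** The inverse Choi correspondence: rho is sent to the partial trace over factor 0 of J (rho^T (x)
    I). *)
Definition choi_map : lin_map R 'I_d (mi N d) :=
  fun rho e f => \sum_a \sum_b rho a b * (J (mcons a e) (mcons b f))%:C.

Lemma choi_map_linear : is_linear choi_map.
Proof.
move=> a A B e f; rewrite /choi_map mulr_sumr -big_split; apply: eq_bigr => k _ /=.
rewrite mulr_sumr -big_split; apply: eq_bigr => l _ /=; ring.
Qed.

(** The spectral decomposition of [J] provides a Kraus form, with one operator for each
    eigenvector. *)
Lemma choi_map_cp : (forall u v, J u v = J v u) ->
  (forall x : mi N.+1 d -> R, 0 <= \sum_u \sum_v x u * J u v * x v) ->
  completely_positive choi_map.
Proof.
move=> symJ psdJ k X psdX.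
have [w [m [m0 dJ]]] := real_psd_decomposition symJ psdJ.
pose B l : op R ('I_k * mi N d)%type := fun i j =>
  \sum_a \sum_b X (i.1, a) (j.1, b) * (w l (mcons a i.2) * Num.conj (w l (mcons b j.2))).
have -> : ampl choi_map X = fun i j => \sum_l (m l)%:C * B l i j.
  apply/funext => i; apply/funext => j; rewrite /ampl /choi_map /B.
  under [RHS]eq_bigr do rewrite mulr_sumr.
  rewrite [RHS]exchange_big; apply: eq_bigr => a _.
  under [RHS]eq_bigr do rewrite mulr_sumr.
  rewrite [RHS]exchange_big; apply: eq_bigr => b _.
  by rewrite dJ mulr_sumr; apply: eq_bigr => l _; rewrite mulrCA.
apply: psd_sum => // l v.
(* [y] is the adjoint of the l-th Kraus operator applied to [v], so the form of [B l] at [v] is that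
   of [X] at [y]. *)
pose y (x : 'I_k * 'I_d) := \sum_f Num.conj (w l (mcons x.2 f)) * v (x.1, f).
have := psdX y; congr (0 <= _).
rewrite sum_pair [RHS]sum_pair.
apply: eq_bigr => p _.
transitivity (\sum_e \sum_a \sum_q \sum_b Num.conj (v (p, e)) * w l (mcons a e) * X (p, a) (q, b) * y (q, b)).
  rewrite [RHS]exchange_big; apply: eq_bigr => a _ /=.
  rewrite [RHS]exchange_big sum_pair /=.
  apply: eq_bigr => q _; rewrite [RHS]exchange_big; apply: eq_bigr => b _.
  rewrite -!mulr_suml; congr (_ * _ * _); rewrite /y rmorph_sum.
  by apply: eq_bigr => e _; rewrite rmorphM /= conjCK mulrC.
apply: eq_bigr => e _.
rewrite sum_pair.
rewrite exchange_big; apply: eq_bigr => q _ /=.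
rewrite /B /=.
under [RHS]eq_bigr do rewrite mulr_sumr mulr_suml.
rewrite [RHS]exchange_big; apply: eq_bigr => a _ /=.
under [RHS]eq_bigr do rewrite mulr_sumr mulr_suml.
rewrite [RHS]exchange_big; apply: eq_bigr => b _ /=.
by rewrite /y mulr_sumr; apply: eq_bigr => f _; ring.
Qed.

(** Grouping by output i lets the same two-site marginals settle both trace preservation and the
    clones. *)
Lemma tr_choi_map (i : 'I_N) A :
  tr (choi_map A) = \sum_c \sum_c' A c c' * (\sum_a marginal2 i J c a c' a)%:C.
Proof.
rewrite /tr /choi_map exchange_big; apply: eq_bigr => c _.
rewrite exchange_big; apply: eq_bigr => c' _; rewrite -mulr_sumr -rmorph_sum; congr (_ * _%:C).
rewrite (partition_big (fun e : mi N d => e i) xpredT) //; apply: eq_bigr => a _.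
rewrite marginal2_mcons; apply: eq_bigr => e /eqP <-.
by rewrite upd_id.
Qed.

Lemma marginal_choi_map (i : 'I_N) A a b :
  marginal choi_map i A a b = \sum_c \sum_c' A c c' * (marginal2 i J c a c' b)%:C.
Proof.
rewrite /marginal /choi_map exchange_big; apply: eq_bigr => c _.
rewrite exchange_big; apply: eq_bigr => c' _; rewrite -mulr_sumr -rmorph_sum; congr (_ * _%:C).
by rewrite marginal2_mcons.
Qed.

End Channel.

Lemma covariant_choi_marginal2 (R : realType) (N d : nat)
  (J : mi N.+1 d -> mi N.+1 d -> R) (i : 'I_N) (p : R) :
  (1 < d)%N -> covariant_choi J -> fidelity J i = p * (d%:R ^+ 2 - 1) + 1 ->
  forall c a c' b, marginal2 i J c a c' b =
    (1 - p) / d%:R * ((c == c') && (a == b))%:R + p * ((c == a) && (c' == b))%:R.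
Proof.
move=> d1 [_ _ trJ covJ] fJ.
(* the trace and the fidelity determine the two coefficients *)
have [al [be M]] := gl_invariant_span d1 (marginal2_covariant i covJ).
have d3 : 1 < d%:R :> R by rewrite ltr1n.
have sumc (k : R) : \sum_(c < d) k = d%:R * k by rewrite sumr_const card_ord mulr_natl.
have dn0 : d%:R != 0 :> R by rewrite gt_eqF //; lra.
have e1 : al * d%:R + be = 1.
  have := marginal2_trace i J; rewrite trJ.
  under eq_bigr => c _.
    under eq_bigr => a _.
      rewrite M !eqxx andbb /= ?andbb mulr1 [_ == a]eq_sym mulrC.
    over.
    rewrite big_split /= sumc sum_deltal.
  over.
  rewrite sumc => H.
  by apply: (mulfI dn0); rewrite mulr1 -[RHS]H; ring.
have e2 : al * d%:R + be * d%:R ^+ 2 = p * (d%:R ^+ 2 - 1) + 1.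
  rewrite -fJ /fidelity -marginal2_omega.
  under eq_bigr => c _.
    under eq_bigr => c' _.
      rewrite M !eqxx andbb /= ?andbb mulr1 [_ == c']eq_sym [al * _]mulrC.
    over.
    rewrite big_split /= sumc sum_deltal.
  over.
  by rewrite sumc; ring.
have D0 : (d%:R ^+ 2 - 1) != 0 :> R by rewrite gt_eqF //; nra.
have be_p : be = p by apply: (mulIf D0); lra.
have al_p : al = (1 - p) / d%:R.
  by apply: (mulIf dn0); rewrite divfK //; lra.
by move=> c a c' b; rewrite M be_p al_p.
Qed.

Lemma covariant_choi_clones (R : realType) (N d : nat)
  (J : mi N.+1 d -> mi N.+1 d -> R) (p : 'I_N -> R) :
  (1 < d)%N -> (0 < N)%N -> covariant_choi J ->
  (forall i, fidelity J i = p i * (d%:R ^+ 2 - 1) + 1) ->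
  quantum_channel (choi_map J) /\
  forall (i : 'I_N) (rho : op R 'I_d), density rho ->
    marginal (choi_map J) i rho = depol (p i) rho.
Proof.
move=> d1 N0 FJ fJ; have M i := covariant_choi_marginal2 d1 FJ (fJ i).
have dn0 : d%:R != 0 :> R by rewrite pnatr_eq0 -lt0n ltnW.
split; [split|].
- exact: choi_map_linear.
- by case: FJ => ? ? _ _; exact: choi_map_cp.
- move=> A; rewrite (tr_choi_map _ (Ordinal N0)) /tr; apply: eq_bigr => c _.
  rewrite -[RHS](sum_deltar c (A c)); apply: eq_bigr => c' _; congr (_ * _).
  under eq_bigr do rewrite M eqxx andbT.
  rewrite big_split /= sumr_const card_ord.
  have [->|/negPf nc] := eqVneq c' c; last first.
    rewrite mulr0 mul0rn add0r big1 // => a _.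
    by case: eqVneq => [<-|_]; rewrite ?nc ?mulr0.
  rewrite mulr1 -[_ *+ d]mulr_natr divfK //.
  under eq_bigr do rewrite andbb mulrC [c == _]eq_sym.
  by rewrite sum_deltal subrK.
- move=> i rho [_ trrho]; apply/funext => a; apply/funext => b.
  rewrite marginal_choi_map /depol.
  pose K := ((1 - p i) / d%:R * (a == b)%:R)%:C.
  transitivity (\sum_c \sum_c' ((c' == c)%:R * (rho c c' * K) +
      (c' == b)%:R * ((c == a)%:R * ((p i)%:C * rho c c')))).
    apply: eq_bigr => c _; apply: eq_bigr => c' _.
    rewrite M -!mulnb !natrM [c == c']eq_sym /K !rmorphD !rmorphM !rmorph_nat /=; ring.
  under eq_bigr do rewrite big_split /= !sum_deltal.
  rewrite big_split /= sum_deltal -mulr_suml -/(tr rho) trrho mul1r addrC /K.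
  by rewrite !rmorphM fmorphV !rmorph_nat /=; ring.
Qed.

(** * Linear extension from density matrices *)

Section Converse.
Variables (R : realType).
Local Notation C := R[i].

Definition op_unit (d : nat) (c c' : 'I_d) : op R 'I_d :=
  fun k l => (k == c)%:R * (l == c')%:R.

(** Cloning is assumed on density matrices, but the Choi operator evaluates the channel on matrix
    units. Normalized rank-one operators are densities, and polarization recovers the units from
    them. *)
Lemma linear_vanishing_on_densities (d : nat) (D : op R 'I_d -> C) :
  (forall a A B, D (fun k l => a * A k l + B k l) = a * D A + D B) ->
  (forall rho, density rho -> D rho = 0) ->
  forall c c', D (op_unit c c') = 0.
Proof.
move=> linD D0 c c'.
have Dz : D (fun _ _ => 0) = 0.
  have := linD (-1) (op_unit c c) (op_unit c c); rewrite mulN1r addNr => H; apply: (etrans _ H).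
  by apply: (congr1 D); apply/funext => k; apply/funext => l; rewrite mulN1r addNr.
have rank1 (v : 'I_d -> C) : \sum_i v i * Num.conj (v i) != 0 ->
    D (fun k l => v k * Num.conj (v l)) = 0.
  set t := \sum_i _ => t0.
  have t_gt : 0 < t by rewrite lt_def t0 sumr_ge0 // => ? _; exact: mul_conjC_ge0.
  have -> : (fun k l => v k * Num.conj (v l)) =
     (fun k l => t * (t^-1 * (v k * Num.conj (v l))) + 0).
    by apply/funext => k; apply/funext => l; rewrite addr0 mulVKf.
  rewrite linD Dz addr0 D0 ?mulr0 //; split; last by rewrite /tr -mulr_sumr mulVf.
  move=> x; have := psd_rank1 v x; rewrite -(pmulr_rge0 _ (_ : 0 < t^-1)) ?invr_gt0 //.
  congr (0 <= _); rewrite mulr_sumr; apply: eq_bigr => k _; rewrite mulr_sumr.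
  by apply: eq_bigr => l _; ring.
have conjb (b : bool) : Num.conj (b%:R : C) = b%:R by rewrite rmorph_nat.
have [<-|cc'] := eqVneq c c'.
  have := rank1 (fun k => (k == c)%:R); rewrite sum_deltal eqxx conjC1 oner_eq0 => /(_ isT) H; apply: (etrans _ H).
  by apply: (congr1 D); apply/funext => k; apply/funext => l; rewrite conjb.
(* polarization over the fourth roots of unity s *)
pose v (s : C) k : C := (k == c)%:R + s * (k == c')%:R.
have vc s k : Num.conj (v s k) = (k == c)%:R + Num.conj s * (k == c')%:R.
  by rewrite /v rmorphD rmorphM /= !conjb.
have norm_v s : \sum_k v s k * Num.conj (v s k) = 1 + s * Num.conj s.
  under eq_bigr do rewrite mulrDl -mulrA.
  rewrite big_split -mulr_sumr /= !sum_deltal /v !eqxx [c' == c]eq_sym (negPf cc').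
  by rewrite mulr0 addr0 add0r mulr1 conjC1.
have Dv s : s * Num.conj s = 1 -> D (fun k l => v s k * Num.conj (v s l)) = 0.
  by move=> ss; apply: rank1; rewrite norm_v ss -mulr2n pnatr_eq0.
have -> : op_unit c c' = fun k l =>
  4^-1 * (v 1 k * Num.conj (v 1 l)) + (- 4^-1 * (v (-1) k * Num.conj (v (-1) l)) +
  ('i / 4 * (v 'i k * Num.conj (v 'i l)) + (- 'i / 4 * (v (- 'i) k * Num.conj (v (- 'i) l)) + 0)))%R.
  apply/funext => k; apply/funext => l; rewrite !vc /op_unit /v !rmorphN /= conjCi conjC1.
  have i2 : 'i * 'i = -1 :> C by rewrite -expr2 sqrCi.
  set A := (k == c)%:R; set A' := (k == c')%:R; set B := (l == c)%:R; set B' := (l == c')%:R.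
  (* The expansion is checked with i as an indeterminate; i^2 = -1 then keeps the first term and
     kills the second. *)
  transitivity (A * B' * ((1 - 'i * 'i) / 2) + A' * B * ((1 + 'i * 'i) / 2) : C).
    by rewrite i2; field.
  by field.
rewrite !linD Dz !Dv ?mulr0 ?addr0 ?conjC1 ?mulr1 //.
- by rewrite rmorphN /= conjCi opprK mulNr -expr2 sqrCi opprK.
- by rewrite conjCi mulrN -expr2 sqrCi opprK.
- by rewrite rmorphN /= conjC1 mulrNN mulr1.
Qed.

End Converse.

(** * Necessity of the dual-norm bound *)

Section Necessity.
Variables (R : realType) (N d : nat).
Local Notation C := R[i].
Local Notation I := (mi N.+1 d).

Lemma psd_pairing_le (S : I -> I -> R) (J : op R I) : (0 < d)%N ->
  (forall u v, S u v = S v u) -> psd J ->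
  \sum_u \sum_v complex.Re (J u v) * S u v <= lambda_max S * complex.Re (tr J).
Proof.
move=> d0 symS psdJ; have [w [m [ow cw dS]]] := real_symmetric_spectral symS.
have := psd_pairing_le_lambda_max symS ow cw dS [ffun=> Ordinal d0] psdJ.
rewrite lecE => /andP[_]; rewrite complex_ReMl; congr (_ <= _).
rewrite complex_Re_sum; apply: eq_bigr => u _; rewrite complex_Re_sum; apply: eq_bigr => v _.
by rewrite [J u v * _]mulrC complex_ReMl mulrC.
Qed.

(** The diagonal entry of [S_op d x] at a constant multi-index is [norm1 x], so [lambda_max] is at
    least [norm1 x], and d > 1 makes the difference positive. *)
Lemma Qnorm_gt0 (x : 'I_N -> R) : (1 < d)%N -> (exists i, x i != 0) -> 0 < Qnorm d x.
Proof.
move=> d1 [i xi].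
have d3 : 1 < d%:R :> R by rewrite ltr1n.
pose u0 : I := [ffun=> Ordinal (ltnW d1)].
have := psd_pairing_le (ltnW d1) (@S_op_sym _ _ _ x) (psd_rank1 (fun u => (u == u0)%:R)).
have -> : tr (fun u v : I => (u == u0)%:R * Num.conj ((v == u0)%:R : C)) = 1.
  by rewrite /tr sum_deltal eqxx conjC1.
have Re_delta u v : complex.Re ((u == u0)%:R * Num.conj ((v == u0)%:R : C)) = (u == u0)%:R * (v == u0)%:R.
  by case: (u == u0); case: (v == u0); rewrite ?conjC1 ?conjC0 ?mulr1 ?mulr0 ?mul0r.
under eq_bigr => u _.
  under eq_bigr => v _ do rewrite Re_delta -mulrA.
  rewrite -mulr_sumr sum_deltal.
over.
rewrite sum_deltal /= mulr1 => le_l.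
have Su : S_op d x u0 u0 = norm1 x.
  rewrite /S_op /norm1; apply: eq_bigr => j _; rewrite /omega_0i.
  by case: omegaP => [_|[]]; rewrite ?mulr1 // !ffunE.
have n0 : 0 < norm1 x.
  rewrite /norm1 (bigD1 i) //= ltr_wpDr ?normr_gt0 //.
  by apply: sumr_ge0 => ? _; exact: normr_ge0.
rewrite Su in le_l.
rewrite /Qnorm divr_gt0 //; nra.
Qed.

Variables (T : lin_map R 'I_d (mi N d)) (p : 'I_N -> R).
Hypothesis chT : quantum_channel T.
Hypothesis clT : forall i rho, density rho -> marginal T i rho = depol (p i) rho.

Let linT : is_linear T. Proof. by case: chT. Qed.

(** [depol] is affine in rho; the factor Tr rho, equal to 1 on densities, makes it linear so that it
    extends to matrix units. *)
Lemma marginal_op_unit i c c' a b : marginal T i (op_unit R c c') a b =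
  (p i)%:C * op_unit R c c' a b + (1 - p i)%:C * (tr (op_unit R c c') * ((a == b)%:R / d%:R)).
Proof.
apply/eqP; rewrite -subr_eq0; apply/eqP.
apply: (@linear_vanishing_on_densities R d (fun rho => marginal T i rho a b -
  ((p i)%:C * rho a b + (1 - p i)%:C * (tr rho * ((a == b)%:R / d%:R))))).
- move=> k A B.
  have -> : marginal T i (fun s t => k * A s t + B s t) a b = k * marginal T i A a b + marginal T i B a b.
    by rewrite /marginal mulr_sumr -big_split; apply: eq_bigr => e _; exact: linT.
  have -> : tr (fun s t => k * A s t + B s t) = k * tr A + tr B.
    by rewrite /tr mulr_sumr -big_split.
  ring.
- by move=> rho drho; rewrite (clT _ drho) /depol; case: drho => _ ->; rewrite mul1r subrr.
Qed.

(** The Choi operator (id (x) T)(omega), with the reference system as factor 0. *)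
Definition choi_op : op R I := fun u v => T (op_unit R (u ord0) (v ord0)) (mtail u) (mtail v).

Lemma choi_op_psd : psd choi_op.
Proof.
apply: (psd_bij (@mcons_bij N d)).
have [_ cpT _] := chT.
pose X : op R ('I_d * 'I_d)%type := fun x y => (x.1 == x.2)%:R * Num.conj ((y.1 == y.2)%:R : C).
have := cpT d X (psd_rank1 _); congr psd.
apply/funext => x; apply/funext => y; rewrite /ampl /choi_op !mcons0 !mconsK.
congr (T _ _ _); apply/funext => k; apply/funext => l.
by rewrite /X /op_unit /= rmorph_nat eq_sym [y.1 == _]eq_sym.
Qed.

Lemma tr_op_unit (c c' : 'I_d) : tr (op_unit R c c') = (c == c')%:R.
Proof. by rewrite /tr /op_unit sum_deltal. Qed.

Lemma choi_op_trace : tr choi_op = d%:R.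
Proof.
have [_ _ tpT] := chT.
rewrite /tr (reindex _ (onW_bij _ (@mcons_bij N d))) sum_pair /=.
under eq_bigr => c _.
  under eq_bigr => e _ do rewrite /choi_op !mcons0 !mconsK.
  rewrite -/(tr _) tpT tr_op_unit eqxx.
over.
by rewrite sumr_const card_ord.
Qed.

Lemma choi_op_fidelity i : (0 < d)%N ->
  fidelity (fun u v => complex.Re (choi_op u v)) i = p i * (d%:R ^+ 2 - 1) + 1.
Proof.
move=> d0; rewrite /fidelity -marginal2_omega.
have dn0 : d%:R != 0 :> R by rewrite pnatr_eq0 -lt0n.
(* The constant part sums to p_i d^2 and the diagonal part to 1 - p_i. *)
transitivity (\sum_(c < d) \sum_(c' < d) (p i + (c' == c)%:R * ((1 - p i) / d%:R))).
  apply: eq_bigr => c _; apply: eq_bigr => c' _.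
  have -> : p i + (c' == c)%:R * ((1 - p i) / d%:R) = complex.Re (marginal T i (op_unit R c c') c c').
    rewrite marginal_op_unit tr_op_unit /op_unit !eqxx [c' == c]eq_sym.
    transitivity (complex.Re (p i + (c == c')%:R * ((1 - p i) / d%:R))%:C) => //; congr complex.Re.
    by rewrite rmorphD !rmorphM fmorphV !rmorph_nat /=; case: (c == c'); rewrite ?(mulr1, mul1r, mulr0, mul0r).
  rewrite marginal2_mcons /marginal complex_Re_sum; apply: eq_bigr => e _.
  by rewrite /choi_op !mcons0 !mconsK.
under eq_bigr do rewrite big_split /= sum_deltal.
have sumc (k : R) : \sum_(c < d) k = d%:R * k by rewrite sumr_const card_ord mulr_natl.
under eq_bigr do rewrite sumc.
by rewrite big_split /= !sumc [X in _ + X]mulrC divfK //; ring.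
Qed.

Lemma clones_le_Qnorm (x : 'I_N -> R) : (1 < d)%N -> (forall i, 0 <= p i) ->
  \sum_i p i * x i <= Qnorm d x.
Proof.
move=> d1 p0.
have d3 : 1 < d%:R :> R by rewrite ltr1n.
have D0 : 0 < (d%:R ^+ 2 - 1) :> R by nra.
have := psd_pairing_le (ltnW d1) (@S_op_sym _ _ _ x) choi_op_psd.
rewrite choi_op_trace -(rmorph_nat (real_complex R)) /=.
have -> : \sum_u \sum_v complex.Re (choi_op u v) * S_op d x u v =
   \sum_i `|x i| * (p i * (d%:R ^+ 2 - 1) + 1).
  under [RHS]eq_bigr do rewrite -(choi_op_fidelity _ (ltnW d1)) /fidelity mulr_sumr.
  rewrite [RHS]exchange_big; apply: eq_bigr => u _.
  under [RHS]eq_bigr do rewrite mulr_sumr.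
  rewrite [RHS]exchange_big; apply: eq_bigr => v _.
  by rewrite /S_op mulr_sumr; apply: eq_bigr => i _; rewrite mulrCA.
move=> H; rewrite /Qnorm ler_pdivlMr // lerBrDr mulrC -[leRHS]mulrC.
apply: le_trans H; rewrite /norm1 mulr_sumr -big_split; apply: ler_sum => i _ /=.
have := ler_norm (x i); have := p0 i; move: (p i) (x i) `|x i| => a b c a0 bc.
(* [S_op] sees |x_i| only; the slack p_i (|x_i| - x_i) (d^2 - 1) is nonnegative because p_i >= 0. *)
have : 0 <= a * (c - b) * (d%:R ^+ 2 - 1) by apply: mulr_ge0; [apply: mulr_ge0 => //; rewrite subr_ge0 | exact: ltW].
suff -> : c * (a * (d%:R ^+ 2 - 1) + 1) = (d%:R ^+ 2 - 1) * (a * b) + c + a * (c - b) * (d%:R ^+ 2 - 1).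
  by rewrite lerDl.
ring.
Qed.

End Necessity.

Theorem mainTheorem1 (R : realType) (N d : nat) (hd : (2 <= d)%N) (hN : (1 <= N)%N)
  (p : 'I_N -> R) (hp : forall i, 0 <= p i <= 1) :
  @cloning_region R N d p <-> (Qnorm_dual d p <= 1%:E)%E.
Proof.
have p0 i : 0 <= p i by have /andP[] := hp i.
split=> [[_ [T [chT clT]]]|H].
  apply: ge_ereal_sup => _ [x nx <-]; rewrite lee_fin.
  rewrite ler_pdivrMr ?mul1r; last exact: Qnorm_gt0.
  exact: (clones_le_Qnorm chT clT).
split=> //.
(* Clearing the positive denominator turns the dual-norm bound into linear inequalities. *)
have dual x : (exists i, x i != 0) -> \sum_i p i * x i <= Qnorm d x.
  move=> nx; rewrite -[leRHS]mul1r -ler_pdivrMr; last exact: Qnorm_gt0.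
  by rewrite -lee_fin; apply: le_trans H; apply: ereal_sup_ubound; exists x.
have [J FJ fJ] := covariant_choi_fidelity hd p0 dual.
have [chJ clJ] := covariant_choi_clones hd hN FJ fJ.
by exists (choi_map J).
Qed.
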